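(* Minimum Sum Coloring with Bundles can be solved in $O(n^3|\mathcal{B}|)$ time, where $n=|V|$, on instances in which $G$ is a path and the subgraph $G[B]$ induced by each bundle $B\in\mathcal{B}$ is connected ($\mathcal{B}$ need not be a partition).
   Context: Minimum Sum Coloring with Bundles: given an undirected graph $G=(V,E)$, a family $\mathcal{B}=\{B_1,\dots,B_\ell\}$ of non-empty subsets of $V$ (bundles) such that every vertex lies in at least one bundle, a weight function $w\colon\mathcal{B}\to\mathbb{Z}_{>0}$ and a positive integer $C$, decide whether there exists a proper coloring $c\colon V\to\mathbb{Z}_{>0}$ (i.e. $c(u)\ne c(v)$ for every edge $uv$) with $\mathrm{cost}(c)=\sum_{j=1}^{\ell} w(B_j)\max\{c(v)\mid v\in B_j\}\le C$ (the algorithm computes the minimum cost). *)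

(* Defs.v *)
From mathcomp Require Import all_boot.
Set Implicit Arguments.
Unset Strict Implicit.
Unset Printing Implicit Defensive.

Record instance := Instance {
  nv : nat;
  adj : rel 'I_nv;
  bundles : {set {set 'I_nv}};
  weight : {set 'I_nv} -> nat;  (* irrelevant outside [bundles] *)
  budget : nat
}.

Definition well_formed (I : instance) : Prop :=
  [/\ symmetric (@adj I) /\ irreflexive (@adj I),
      set0 \notin bundles I,
      cover (bundles I) = [set: 'I_(nv I)],
      (forall B, B \in bundles I -> 0 < weight B)
    & 0 < budget I].

Definition proper_coloring (I : instance) (c : 'I_(nv I) -> nat) : Prop :=
  (forall v, 0 < c v) /\ (forall u v, adj u v -> c u <> c v).

Definition cost (I : instance) (c : 'I_(nv I) -> nat) : nat :=
  \sum_(B in bundles I) weight B * \max_(v in B) c v.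

Definition yes_instance (I : instance) : Prop :=
  exists c : 'I_(nv I) -> nat, proper_coloring c /\ cost c <= budget I.

Definition is_min_cost (I : instance) (m : nat) : Prop :=
  (exists c : 'I_(nv I) -> nat, proper_coloring c /\ cost c = m) /\
  (forall c : 'I_(nv I) -> nat, proper_coloring c -> m <= cost c).

(* [s] maps each vertex to its position along the path; a path has at least
   one vertex. *)
Definition is_path (n : nat) (e : rel 'I_n) : Prop :=
  0 < n /\
  exists s : 'I_n -> 'I_n, injective s /\
    forall u v, e u v = (((s u).+1 == s v :> nat) || ((s v).+1 == s u :> nat)).

Definition induced (T : finType) (e : rel T) (B : {set T}) : rel T :=
  [rel u v | [&& u \in B, v \in B & e u v]].

Definition induced_connected (T : finType) (e : rel T) (B : {set T}) : Prop :=
  {in B &, forall u v, connect (induced e B) u v}.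

(* Uniform-cost random access machine, in structured form: natural-number
   registers named by constants of the program, and a memory addressed through
   registers.  Each assignment and each test takes one unit of time.  The only
   arithmetic is addition and truncated subtraction; as there is no
   multiplication or shift, the values reached in t steps have at most t bits
   more than the largest number of the program and the input. *)
Inductive cmd :=
| Skip
| Const (r k : nat)
| Add (r a b : nat)
| Sub (r a b : nat)
| Fetch (r a : nat)
| Store (a b : nat)
| Seq (p q : cmd)
| If (r : nat) (p q : cmd)
| While (r : nat) (p : cmd).

Record state := State { reg : nat -> nat; mem : nat -> nat }.

Definition upd (f : nat -> nat) (i v : nat) : nat -> nat :=
  fun j => if j == i then v else f j.

Definition set_reg (s : state) (r v : nat) : state :=
  State (upd (reg s) r v) (mem s).

Definition set_mem (s : state) (i v : nat) : state :=
  State (reg s) (upd (mem s) i v).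

(* [exec p s t s']: started in [s], [p] halts in [s'] after exactly [t] steps. *)
Inductive exec : cmd -> state -> nat -> state -> Prop :=
| exec_skip s : exec Skip s 1 s
| exec_const r k s : exec (Const r k) s 1 (set_reg s r k)
| exec_add r a b s : exec (Add r a b) s 1 (set_reg s r (reg s a + reg s b))
| exec_sub r a b s : exec (Sub r a b) s 1 (set_reg s r (reg s a - reg s b))
| exec_fetch r a s : exec (Fetch r a) s 1 (set_reg s r (mem s (reg s a)))
| exec_store a b s : exec (Store a b) s 1 (set_mem s (reg s a) (reg s b))
| exec_seq p q s s1 s2 t1 t2 :
    exec p s t1 s1 -> exec q s1 t2 s2 -> exec (Seq p q) s (t1 + t2) s2
| exec_if_true r p q s s1 t :
    0 < reg s r -> exec p s t s1 -> exec (If r p q) s t.+1 s1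
| exec_if_false r p q s s1 t :
    reg s r = 0 -> exec q s t s1 -> exec (If r p q) s t.+1 s1
| exec_while_true r p s s1 s2 t1 t2 :
    0 < reg s r -> exec p s t1 s1 -> exec (While r p) s1 t2 s2 ->
    exec (While r p) s (t1 + t2).+1 s2
| exec_while_false r p s :
    reg s r = 0 -> exec (While r p) s 1 s.

Definition init (x : seq nat) : state := State (fun _ => 0) (fun i => nth 0 x i).

Definition edge_list (n : nat) (e : rel 'I_n) (es : seq ('I_n * 'I_n)) : Prop :=
  [/\ uniq es,
      (forall u v, (u, v) \in es -> (v, u) \notin es)
    & (forall u v, e u v = ((u, v) \in es) || ((v, u) \in es))].

Definition bundle_list (n : nat) (Bs : {set {set 'I_n}}) (bs : seq (seq 'I_n)) :
    Prop :=
  all uniq bs /\ perm_eq [seq [set v in b] | b <- bs] (enum Bs).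

(* An instance has many encodings: edges come in any order and orientation,
   bundles in any order, and so do the vertices within a bundle. *)
Definition encodes (I : instance) (x : seq nat) : Prop :=
  exists (es : seq ('I_(nv I) * 'I_(nv I))) (bs : seq (seq 'I_(nv I))),
    [/\ edge_list (@adj I) es, bundle_list (bundles I) bs
      & x = [:: nv I; size es; size bs; budget I]
            ++ flatten [seq [:: val uv.1; val uv.2] | uv <- es]
            ++ flatten [seq [:: weight [set v in b], size b & map val b]
                       | b <- bs]].

(* Minimum Sum Coloring with Bundles restricted to the instances satisfying [P]
   is solved in time O(f) by one program, which answers the decision problem in
   register 0 (nonzero = yes) and leaves the minimum cost in register 1.  Both
   the program and the constant are uniform in the instance. *)
Definition solvable_in_time (P : instance -> Prop) (f : instance -> nat) : Prop :=
  exists (p : cmd) (k : nat),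
    forall (I : instance) (x : seq nat),
      well_formed I -> P I -> encodes I x ->
      exists (t : nat) (s : state),
        [/\ exec p (init x) t s, t <= k * f I,
            0 < reg s 0 <-> yes_instance I
          & is_min_cost I (reg s 1)].

(* Main.v *)
(* A path vertex always has a colour in {1,2,3} missing from its at most two
   neighbours, so an optimal colouring uses only these three colours.  Bundles
   are intervals: the maximum over a bundle B with at least two vertices is 2,
   plus 1 when B contains a 3, and over a singleton it is the colour itself.
   Scanning the path, a bundle is charged for its 3 at the first one it meets,
   that is at a vertex v of B coloured 3 such that the previous vertex u
   coloured 3 is not in B.  Hence the cost is a constant plus a sum, over the
   vertices, of terms depending on the colour of v, on v and on u only, and it
   is minimised by dynamic programming over the pairs (u, colour of v): O(n)
   values of u for each of the n vertices, and a scan of all bundles, in time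
   O(n |B|), for each of these O(n^2) pairs.
   The order of the path is found by walking n steps from an arbitrary vertex,
   which ends at an endpoint, and walking back from there. *)
Require Import Defs.
From mathcomp Require Import all_boot zify.
(* MathComp has its own [Sub] and [mem]. *)
Import Defs.
Set Implicit Arguments.
Unset Strict Implicit.
Unset Printing Implicit Defensive.

(** * Timed correctness of programs *)

Definition runs p s T (Q : state -> Prop) :=
  exists t s', [/\ exec p s t s', t <= T & Q s'].

Lemma runs_weaken p s T T' (Q Q' : state -> Prop) :
  runs p s T Q -> T <= T' -> (forall s', Q s' -> Q' s') -> runs p s T' Q'.
Proof.
move=> [t [s' [e le q]]] leT QQ; exists t, s'; split => //.
  exact: leq_trans leT.
exact: QQ.
Qed.

Lemma runs_seq p q s T1 T2 Q :
  runs p s T1 (fun s1 => runs q s1 T2 Q) -> runs (Seq p q) s (T1 + T2) Q.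
Proof.
move=> [t1 [s1 [e1 le1 [t2 [s2 [e2 le2 Q2]]]]]].
exists (t1 + t2), s2; split => //; first exact: exec_seq e1 e2.
exact: leq_add.
Qed.

(** * Loop-free code: weakest preconditions and running time *)

Definition ups (f : nat -> nat) i v : nat -> nat :=
  fun j => if Nat.eqb j i then v else f j.

(** Computed values enter as variables with an equation, which keeps terms small. Loops get [False],
    being left to [runs_while]. Registers use [ups], whose test computes on literal register
    names. *)
Fixpoint wp p (Q : (nat -> nat) -> (nat -> nat) -> Prop) R M : Prop :=
  match p with
  | Skip => Q R M
  | Const r k => Q (ups R r k) M
  | Add r a b => forall v, v = R a + R b -> Q (ups R r v) M
  | Sub r a b => forall v, v = R a - R b -> Q (ups R r v) M
  | Fetch r a => forall v, v = M (R a) -> Q (ups R r v) M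
  | Store a b => Q R (upd M (R a) (R b))
  | Seq p q => wp p (wp q Q) R M
  | If r p q => (0 < R r -> wp p Q R M) /\ (R r = 0 -> wp q Q R M)
  | While _ _ => False
  end.

Fixpoint tm p :=
  match p with
  | Seq p q => tm p + tm q
  | If _ p q => (maxn (tm p) (tm q)).+1
  | _ => 1
  end.

Lemma runs_wp p s T (Q : state -> Prop) :
  tm p <= T -> wp p (fun R M => Q (State R M)) (reg s) (mem s) -> runs p s T Q.
Proof.
move=> leT Qs; apply: (@runs_weaken _ _ (tm p) _ Q) => // {T leT}.
have {Qs} : exists2 P, wp p P (reg s) (mem s) &
  forall R M, P R M -> Q (State R M) by eexists; [exact: Qs|].
elim: p s Q => //=.
- move=> [R M] Q [P Ps PQ]; exists 1, (State R M).
  by split => //; [constructor | exact: PQ].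
- move=> r k s Q [P Ps PQ]; eexists 1, _; split; [|by []|exact: PQ Ps].
  constructor.
- move=> r a b s Q [P Ps PQ]; eexists 1, _.
  split; [|by []|exact: PQ (Ps _ erefl)]; constructor.
- move=> r a b s Q [P Ps PQ]; eexists 1, _.
  split; [|by []|exact: PQ (Ps _ erefl)]; constructor.
- move=> r a s Q [P Ps PQ]; eexists 1, _.
  split; [|by []|exact: PQ (Ps _ erefl)]; constructor.
- move=> a b s Q [P Ps PQ]; eexists 1, _; split; [|by []|exact: PQ Ps].
  constructor.
- move=> p IHp q IHq s Q [P Ps PQ]; apply: runs_seq.
  apply: (IHp s (fun s1 => runs q s1 (tm q) Q)).
  by exists (wp q P) => // R M Qs; apply: IHq; exists P.
- move=> r p IHp q IHq s Q [P [Pp Pq] PQ].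
  have [rs0|rs] := posnP (reg s r).
  have [|t [s' [e l Q']]] := IHq s Q; first by exists P => //; exact: Pq.
  exists t.+1, s'; split => //; first exact: exec_if_false.
  by rewrite ltnS (leq_trans l) // leq_maxr.
  have [|t [s' [e l Q']]] := IHp s Q; first by exists P => //; exact: Pp.
  exists t.+1, s'; split => //; first exact: exec_if_true.
  by rewrite ltnS (leq_trans l) // leq_maxl.
by move=> r p _ s Q [P []].
Qed.

(** * Frames: what a program leaves unchanged *)

Fixpoint mods p :=
  match p with
  | Const r _ | Add r _ _ | Sub r _ _ | Fetch r _ => [:: r]
  | Seq p q | If _ p q => mods p ++ mods q
  | While _ p => mods p
  | _ => [::]
  end.

Fixpoint nostore p :=
  match p with
  | Store _ _ => false
  | Seq p q | If _ p q => nostore p && nostore q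
  | While _ p => nostore p
  | _ => true
  end.

(** Specifications can thus mention only what they compute: the side conditions on [mods] and
    [nostore] are settled by evaluation. *)
Definition frame p s s' :=
  (forall r, r \notin mods p -> reg s' r = reg s r) /\
  (nostore p -> mem s' = mem s).

Lemma frame_refl p s : frame p s s. Proof. by []. Qed.

Lemma frame_trans p s1 s2 s3 : frame p s1 s2 -> frame p s2 s3 -> frame p s1 s3.
Proof.
move=> [f1 g1] [f2 g2]; split=> [r nr|ns]; first by rewrite f2 // f1.
by rewrite g2 // g1.
Qed.

Lemma exec_frame p s t s' : exec p s t s' -> frame p s s'.
Proof.
elim=> {p s t s'}; rewrite /frame /=; try by move=> *; split.
1-4: move=> *; split=> // r'; rewrite inE /upd => /negbTE -> //.
- move=> p q s s1 s2 t1 t2 _ [f1 g1] _ [f2 g2]; split=> [r|/andP[np nq]].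
    by rewrite mem_cat negb_or => /andP[rp rq]; rewrite f2 // f1.
  by rewrite g2 // g1.
- move=> r p q s s1 t _ _ [f1 g1]; split=> [r'|/andP[np nq]]; last exact: g1.
  by rewrite mem_cat negb_or => /andP[rp rq]; rewrite f1.
- move=> r p q s s1 t _ _ [f1 g1]; split=> [r'|/andP[np nq]]; last exact: g1.
  by rewrite mem_cat negb_or => /andP[rp rq]; rewrite f1.
- move=> r p s s1 s2 t1 t2 _ _ [f1 g1] _ [f2 g2]; split=> [r' nr|ns].
    by rewrite f2 // f1.
  by rewrite g2 // g1.
Qed.

Lemma runs_frame p s T Q :
  runs p s T Q -> runs p s T (fun s' => Q s' /\ frame p s s').
Proof.
move=> [t [s' [e le q]]]; exists t, s'; split => //; split => //.
exact: exec_frame e.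
Qed.

Lemma runs_cut p q s T1 T2 T (P Q : state -> Prop) :
  runs p s T1 P -> T1 + T2 <= T ->
  (forall s1, frame p s s1 -> P s1 -> runs q s1 T2 Q) -> runs (Seq p q) s T Q.
Proof.
move=> rp leT rq; apply: runs_weaken leT (fun _ => id); apply: runs_seq.
by apply: runs_weaken (runs_frame rp) (leqnn _) _ => s1 [? ?]; exact: rq.
Qed.

(** The invariant is indexed by the list of items still to be treated, whose length is the variant.
    Each round costs [T] and one test; the final test accounts for the outer [.+1]. *)
Lemma runs_while A (I : seq A -> state -> Prop) T r p s0 l T' Q :
  I l s0 -> (T.+1 * size l).+1 <= T' ->
  (forall s, frame p s0 s -> I [::] s -> reg s r = 0 /\ Q s) ->
  (forall a l s, frame p s0 s -> I (a :: l) s ->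
     0 < reg s r /\ runs p s T (I l)) ->
  runs (While r p) s0 T' Q.
Proof.
move=> Il leT I0 IS; apply: runs_weaken leT (fun _ => id).
suff gen s : I l s -> frame p s0 s -> runs (While r p) s (T.+1 * size l).+1 Q.
  exact: gen Il (frame_refl p s0).
elim: l {Il} s => [|a l IH] s Is fs.
  have [r0 Qs] := I0 s fs Is.
  by exists 1, s; split => //; apply: exec_while_false.
have [rs /runs_frame[t1 [s1 [e1 l1 [I1 f1]]]]] := IS a l s fs Is.
have [t2 [s2 [e2 l2 Q2]]] := IH s1 I1 (frame_trans fs f1).
exists (t1 + t2).+1, s2; split => //; first exact: exec_while_true e2.
by rewrite /= mulnS; lia.
Qed.

(** * Lists laid out in memory *)

Fixpoint memat (m : nat -> nat) a l :=
  if l is x :: l' then m a = x /\ memat m a.+1 l' else True.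

Lemma memat_cat m a l1 l2 :
  memat m a (l1 ++ l2) <-> memat m a l1 /\ memat m (a + size l1) l2.
Proof.
elim: l1 a => [|x l1 IH] a /=; first by rewrite addn0; tauto.
by rewrite IH addSnnS; tauto.
Qed.

Lemma memat_frame m m' a l :
  (forall i, a <= i < a + size l -> m' i = m i) -> memat m a l -> memat m' a l.
Proof.
elim: l a => //= x l IH a mm [ma ml]; split; first by rewrite mm //; lia.
by apply: IH ml => i ?; apply: mm; lia.
Qed.

Lemma memat_nth (m : nat -> nat) a l :
  (forall i, m (a + i) = nth 0 l i) -> memat m a l.
Proof.
elim: l a => //= x l IH a H; split; first by rewrite -[a]addn0 H.
by apply: IH => i; rewrite addSnnS H.
Qed.

Lemma memat_upd m i v a l :
  i < a \/ a + size l <= i -> memat m a l -> memat (upd m i v) a l.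
Proof. by move=> di; apply: memat_frame => j ?; rewrite /upd; case: eqP => //; lia. Qed.

Lemma upd_ne m i v j : j != i -> upd m i v j = m j.
Proof. by rewrite /upd => /negbTE->. Qed.

Lemma upd_eq m i v : upd m i v i = v.
Proof. by rewrite /upd eqxx. Qed.

Notation "p ;; q" := (Seq p q) (at level 60, right associativity).
Notation rTmp := 2 (only parsing).
Notation rD1 := 3 (only parsing).
Notation rD2 := 4 (only parsing).

Definition Mov r a := Const rTmp 0 ;; Add r a rTmp.
Definition Incr r := Const rTmp 1 ;; Add r r rTmp.
Definition Decr r := Const rTmp 1 ;; Sub r r rTmp.
(** Subtraction being truncated, the sum of the two differences vanishes exactly when the registers
    agree. *)
Definition IfEq a b p q :=
  Sub rD1 a b ;; Sub rD2 b a ;; Add rD1 rD1 rD2 ;; If rD1 q p.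
Definition Next r a := Fetch r a ;; Incr a.
Definition Push a r := Store a r ;; Incr a.


Arguments upd f i v j : simpl never.

Lemma diff_pos x y z a b :
  x = a - b -> y = b - a -> z = x + y -> 0 < z -> (a == b) = false.
Proof. lia. Qed.

Lemma diff_zero x y z a b :
  x = a - b -> y = b - a -> z = x + y -> z = 0 -> (a == b) = true.
Proof. lia. Qed.

Ltac branch :=
  repeat match goal with
  | Hx : ?x = ?a - ?b, Hy : ?y = ?b - ?a, Hz : ?z = ?x + ?y,
    H : is_true (0 < ?z) |- _ =>
      move: (diff_pos Hx Hy Hz H); clear Hx Hy Hz H;
      let E := fresh "E" in intro E
  | Hx : ?x = ?a - ?b, Hy : ?y = ?b - ?a, Hz : ?z = ?x + ?y, H : ?z = 0 |- _ =>
      move: (diff_zero Hx Hy Hz H); clear Hx Hy Hz H;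
      let E := fresh "E" in intro E
  | |- _ /\ _ => split
  | |- forall _, _ => intro
  end.

Ltac lookup := repeat first [rewrite upd_eq | rewrite upd_ne; [|by lia]].

Ltac subst_lhs :=
  repeat match goal with H : ?x = _ |- _ => is_var x; subst x end.

Ltac arith :=
  repeat match goal with H : @eq bool _ _ |- _ => clear H end; lia.

Ltac sexec p :=
  apply: runs_wp; [by [] |
  lazy beta iota delta [wp ups Nat.eqb p Mov Incr Decr IfEq Next Push];
  branch].

(** * Scanning the bundles *)

(* Registers: [rN], [rM], [rNB], [rBud] hold the header of the input, [rBP] the
   address of the bundles and [rEnd] the first free address, where the path
   order is stored; [rPrev], [rCur], [rNxt] belong to the walk.  The table of
   the dynamic program has [rLN] entries between addresses [rLS] and [rLE]; it
   is updated from vertex [rU] to vertex [rV], [rEU] being the last vertex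
   coloured 3 for the current entry.  [rHV] and [rHU] tell whether the current
   bundle contains [rV] and [rEU]. *)
Notation rN := 5 (only parsing).
Notation rM := 6 (only parsing).
Notation rNB := 7 (only parsing).
Notation rBud := 8 (only parsing).
Notation rBP := 9 (only parsing).
Notation rEnd := 10 (only parsing).
Notation rK := 11 (only parsing).
Notation rPrev := 12 (only parsing).
Notation rCur := 13 (only parsing).
Notation rNxt := 14 (only parsing).
Notation rEP := 15 (only parsing).
Notation rEC := 16 (only parsing).
Notation rA := 17 (only parsing).
Notation rB := 18 (only parsing).
Notation rOut := 19 (only parsing).
Notation rWC := 20 (only parsing).
Notation rLS := 21 (only parsing).
Notation rLE := 22 (only parsing).
Notation rLN := 23 (only parsing).
Notation rT := 24 (only parsing).
Notation rU := 25 (only parsing).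
Notation rVP := 26 (only parsing).
Notation rVC := 27 (only parsing).
Notation rV := 28 (only parsing).
Notation rP := 29 (only parsing).
Notation rPC := 30 (only parsing).
Notation rW := 31 (only parsing).
Notation rSz := 32 (only parsing).
Notation rHV := 33 (only parsing).
Notation rHU := 34 (only parsing).
Notation rXC := 35 (only parsing).
Notation rX := 36 (only parsing).
Notation rC3 := 37 (only parsing).
Notation rS := 38 (only parsing).
Notation rLP := 39 (only parsing).
Notation rLC := 40 (only parsing).
Notation rEU := 41 (only parsing).
Notation rM1 := 44 (only parsing).

Definition scan_bundle_body :=
  Next rX rP ;; Decr rXC ;;
  IfEq rV rX (Const rHV 1) Skip ;; IfEq rEU rX (Const rHU 1) Skip.

Lemma scan_bundleP s b V U :
  reg s rV = V -> reg s rEU = U ->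
  memat (mem s) (reg s rP) b -> reg s rXC = size b ->
  runs (While rXC scan_bundle_body) s (20 * size b).+1 (fun s' =>
    [/\ (0 < reg s' rHV) = (0 < reg s rHV) || (V \in b),
        (0 < reg s' rHU) = (0 < reg s rHU) || (U \in b)
      & reg s' rP = reg s rP + size b]).
Proof.
move=> eV eU Mb Cb.
(* Each flag is invariant once combined with membership in the unread part [l]. *)
pose I l s' := [/\ memat (mem s) (reg s' rP) l, reg s' rXC = size l,
  (0 < reg s' rHV) || (V \in l) = (0 < reg s rHV) || (V \in b),
  (0 < reg s' rHU) || (U \in l) = (0 < reg s rHU) || (U \in b)
  & reg s' rP + size l = reg s rP + size b].
apply: (runs_while (T := 19) (I := I) (l := b)) => //.
  move=> s' _ [/= _ C HV HU P]; split => //.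
  by rewrite !orbF addn0 in HV HU P; split.
move=> a l s' [fr /(_ isT) fm] [/= [Ma Ml] C HV HU P]; split; first by lia.
have := fr rV isT; have := fr rEU isT; rewrite {}eU {}eV => eU eV.
rewrite inE in HV; rewrite inE in HU; rewrite -fm in Ma Ml.
sexec scan_bundle_body; rewrite /I /= -fm; subst v; rewrite Ma eU eV in E E0.
all: have -> : v0 = (reg s' 29).+1 by arith.
all: have -> : v1 = size l by arith.
all: split=> //; [rewrite -HV|rewrite -HU|arith].
all: by rewrite ?E ?E0 ?eqxx ?orbT.
Qed.

(* A bundle is a pair (weight, list of vertices). *)
Definition alone (v : nat) (b : nat * seq nat) := (v \in b.2) && (size b.2 <= 1).
(** Since [base_cost] counts 1 for a singleton and 2 for a larger bundle, colour 2 at [v] adds a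
    unit only to a bundle reduced to [v]. *)
Definition single_cost (bl : seq (nat * seq nat)) v :=
  \sum_(b <- bl) b.1 * alone v b.
(** Here [u] is the last vertex coloured 3 before [v]. A singleton pays two units, one from each
    summand, which lifts its 1 to 3. *)
Definition three_cost (bl : seq (nat * seq nat)) u v :=
  \sum_(b <- bl) b.1 * (((v \in b.2) && (u \notin b.2)) + alone v b).
Definition base_cost (bl : seq (nat * seq nat)) :=
  \sum_(b <- bl) b.1 * (1 < size b.2).+1.
Definition bundle_code (bl : seq (nat * seq nat)) :=
  flatten [seq b.1 :: size b.2 :: b.2 | b <- bl].

Definition scan_bundles_init :=
  Const rC3 0 ;; Const rS 0 ;; Mov rP rBP ;; Mov rPC rNB.
Definition scan_bundles_head :=
  Next rW rP ;; Next rSz rP ;; Decr rPC ;; Const rHV 0 ;; Const rHU 0 ;;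
  Mov rXC rSz.
Definition scan_bundles_tail :=
  If rHV
    (If rHU Skip (Add rC3 rC3 rW) ;; Decr rSz ;;
     If rSz Skip (Add rC3 rC3 rW ;; Add rS rS rW))
    Skip.
Definition scan_bundles_body :=
  scan_bundles_head ;; While rXC scan_bundle_body ;; scan_bundles_tail.
Definition scan_bundles :=
  scan_bundles_init ;; While rPC scan_bundles_body.

Lemma scan_bundlesP s bl n V U :
  reg s rV = V -> reg s rEU = U -> reg s rNB = size bl ->
  memat (mem s) (reg s rBP) (bundle_code bl) ->
  all (fun b => size b.2 <= n) bl ->
  runs scan_bundles s (20 + (20 * n + 50) * size bl) (fun s' =>
    reg s' rC3 = three_cost bl U V /\ reg s' rS = single_cost bl V).
Proof.
move=> eV eU eNB Mb ab.
apply: (runs_cut (T1 := 10) (T2 := ((20 * n + 48).+1 * size bl).+1)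
  (P := fun s1 => [/\ reg s1 rC3 = 0, reg s1 rS = 0, reg s1 rP = reg s rBP,
    reg s1 rPC = size bl & mem s1 = mem s])); [|lia|].
  by sexec scan_bundles_init; split=> //=; subst; rewrite addn0.
move=> s1 [fr1 _] [C31 S1 P1 PC1 fm1]; rewrite -P1 -fm1 in Mb.
pose I l s' := [/\ memat (mem s1) (reg s' rP) (bundle_code l),
  reg s' rPC = size l, all (fun b => size b.2 <= n) l,
  reg s' rC3 + three_cost l U V = three_cost bl U V
  & reg s' rS + single_cost l V = single_cost bl V].
apply: (runs_while (T := 20 * n + 48) (I := I) (l := bl)) => //=.
- by split; rewrite //= ?C31 ?S1.
- move=> s' _ [_ C _ H3 HS]; split => //.
  by move: H3 HS; rewrite /three_cost /single_cost !big_nil !addn0.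
move=> b l s2 [fr2 /(_ isT) fm2] [/= Mbl C /andP[ab1 ab2] H3 HS].
split; first by lia.
have eV2 : reg s2 rV = V by rewrite fr2 // fr1.
have eU2 : reg s2 rEU = U by rewrite fr2 // fr1.
case: Mbl => Mw [Ms /memat_cat[Mb1 Mb2]]; rewrite -fm2 in Mw Ms Mb1 Mb2.
apply: (runs_cut (T1 := 13) (T2 := (20 * size b.2).+1 + 10)
  (P := fun s3 => [/\
    [/\ reg s3 rW = b.1, reg s3 rSz = size b.2 & reg s3 rXC = size b.2],
    reg s3 rHV = 0, reg s3 rHU = 0, reg s3 rPC = size l & reg s3 rP = (reg s2 rP).+2])).
- sexec scan_bundles_head.
  by subst; rewrite /= !addn1 !addn0 Mw Ms C subn1.
- lia.
move=> s3 [fr3 /(_ isT) fm3] [[W3 Sz3 XC3] HV3 HU3 PC3 P3].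
apply: (runs_cut (scan_bundleP (V := V) (U := U) _ _ _ XC3)).
- by rewrite fr3.
- by rewrite fr3.
- by rewrite P3 fm3.
- exact: leqnn.
move=> s4 [fr4 /(_ isT) fm4]; rewrite HV3 HU3 P3 /= => -[HV4 HU4 P4].
have W4 : reg s4 rW = b.1 by rewrite fr4.
have Sz4 : reg s4 rSz = size b.2 by rewrite fr4.
have PC4 : reg s4 rPC = size l by rewrite fr4.
rewrite -(fr3 rC3) // -(fr4 rC3) // -(fr3 rS) // -(fr4 rS) // in H3 HS.
rewrite /three_cost /single_cost !big_cons /alone -HV4 -HU4 in H3 HS.
rewrite -P4 fm2 in Mb2.
have sz1 : (size b.2 <= 1) = ~~ (0 < reg s4 rSz - 1) by arith.
rewrite sz1 in H3 HS.
sexec scan_bundles_tail; split => //=; rewrite /three_cost /single_cost -?H3 -?HS.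
all: subst; rewrite ?W4; repeat match goal with
  | H : is_true _ |- _ => rewrite H; clear H
  | H : _ = 0 |- _ => rewrite H; clear H end.
all: rewrite /= ?muln0 ?muln1 ?muln2 -?addnn ?addnA.
all: done.
Qed.

(** * The dynamic program *)

Notation rLA := 42 (only parsing).
Notation rLB := 43 (only parsing).
Notation rY := 45 (only parsing).
Notation rX1 := 46 (only parsing).

(* The minimum of [m - 1] and [x], plus 1, where [m = 0] stands for infinity. *)
Definition upmin m x := if (m == 0) || (x < m) then x.+1 else m.
Definition update_min :=
  If rM1 (Sub rD1 rM1 rX1 ;; If rD1 (Mov rM1 rX1 ;; Incr rM1) Skip)
         (Mov rM1 rX1 ;; Incr rM1).

Lemma update_minP s :
  runs update_min s 9 (fun s' => reg s' rM1 = upmin (reg s rM1) (reg s rX1)).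
Proof. by sexec update_min; rewrite /= /upmin; case: ifP => ?; lia. Qed.

Definition entry_code (L : seq (nat * nat * nat)) :=
  flatten [seq [:: e.1.1; e.1.2; e.2] | e <- L].

Lemma size_entry_code L : size (entry_code L) = 3 * size L.
Proof. by rewrite /entry_code; elim: L => //= e L ->; lia. Qed.

(** Colours 1 and 2 alternate between two vertices coloured 3: colour 1 follows the old colour 2 at
    no charge, and colour 2 follows the old colour 1 with the singleton surcharge. *)
Definition swap_entry bl v (e : nat * nat * nat) :=
  (e.1.1, e.2, e.1.2 + single_cost bl v).
(** Colour 3 at [v] may follow colour 1 or 2, with the same charge, as both values share the last
    vertex coloured 3. The minimum is kept shifted by one; [dp] undoes this with [.-1]. *)
Definition best_step bl v m (e : nat * nat * nat) :=
  upmin (upmin m (e.1.2 + three_cost bl e.1.1 v)) (e.2 + three_cost bl e.1.1 v).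

(* An entry (w, A, B) of [L] holds the minimal costs A and B of a prefix whose
   last vertex coloured 3 is w and whose last colour is 1, resp. 2; [T] is the
   minimal cost when the last vertex, [u], has colour 3. *)
Fixpoint dp bl L T u vs :=
  if vs is v :: vs' then
    dp bl (rcons (map (swap_entry bl v) L) (u, T, T + single_cost bl v))
       (foldl (best_step bl v) 0 L).-1 v vs'
  else T.

Definition entry_head := Next rEU rLP ;; Decr rLC.
Definition entry_swap :=
  Fetch rLA rLP ;; Mov rY rLP ;; Incr rY ;; Fetch rLB rY ;;
  Add rX1 rLA rS ;; Push rLP rLB ;; Push rLP rX1 ;; Add rX1 rLA rC3.
Definition entry_min :=
  update_min ;; Add rX1 rLB rC3 ;; update_min.
Definition entry_body := entry_head ;; scan_bundles ;; entry_swap ;; entry_min.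

Lemma entry_minP s A B c :
  reg s rX1 = A + c -> reg s rLB = B -> reg s rC3 = c ->
  runs entry_min s 20 (fun s' => reg s' rM1 = upmin (upmin (reg s rM1) (A + c)) (B + c)).
Proof.
move=> eX eB eC.
apply: (runs_cut (update_minP s) (T2 := 11)) => // s1 [fr1 _] M1.
apply: (runs_cut (T1 := 1) (T2 := 9) (P := fun s2 => reg s2 rX1 = B + c)) => //.
  by apply: runs_wp => //= v ->; rewrite /ups /= !fr1 // eB eC.
move=> s2 [fr2 _] X2; rewrite -eX -M1 -X2 -(fr2 rM1) //.
exact: update_minP.
Qed.

(** The table is rewritten in place, above the bundles, which stay readable. The last clause keeps
    [rS] for the entry appended by [dp_tail]: it depends on [V] only, so the scan made for any entry
    provides it. *)
Lemma entry_loopP s bl n V L :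
  reg s rV = V -> reg s rNB = size bl ->
  memat (mem s) (reg s rBP) (bundle_code bl) ->
  all (fun b => size b.2 <= n) bl ->
  reg s rBP + size (bundle_code bl) <= reg s rLP ->
  memat (mem s) (reg s rLP) (entry_code L) -> reg s rLC = size L ->
  runs (While rLC entry_body) s (((20 * n + 50) * size bl + 100) * size L).+1
    (fun s' => [/\ memat (mem s') (reg s rLP) (entry_code (map (swap_entry bl V) L)),
       (forall i, i < reg s rLP -> mem s' i = mem s i),
       reg s' rM1 = foldl (best_step bl V) (reg s rM1) L
     & (0 < size L -> reg s' rS = single_cost bl V)]).
Proof.
move=> eV eNB Mb ab dis ML eLC.
(* [done] is the part of the table already swapped in memory. *)
pose I l s' := exists done, [/\ L = done ++ l /\ reg s' rLC = size l,
  reg s' rLP = reg s rLP + size (entry_code done),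
  memat (mem s') (reg s rLP) (entry_code (map (swap_entry bl V) done)) /\
  memat (mem s') (reg s' rLP) (entry_code l),
  (forall i, i < reg s rLP -> mem s' i = mem s i)
  & foldl (best_step bl V) (reg s' rM1) l = foldl (best_step bl V) (reg s rM1) L
    /\ (0 < size done -> reg s' rS = single_cost bl V)].
apply: (runs_while (T := (20 * n + 50) * size bl + 99) (I := I) (l := L)).
- by exists [::]; split; rewrite //= addn0.
- by rewrite -addnS.
- move=> s1 _ [done [[-> C] P [M1 _] fM [B S]]]; rewrite cats0 in B S *.
  by split=> //; split.
move=> e l s1 [fr1 _] [done [[eL C] P [M1 /= [Mu [MA [MB M2]]]] fM [B S]]].
split; first by rewrite C.
have V1 : reg s1 rV = V by rewrite fr1.
have NB1 : reg s1 rNB = size bl by rewrite fr1.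
have Mb1 : memat (mem s1) (reg s1 rBP) (bundle_code bl).
  by rewrite fr1 //; apply: memat_frame Mb => i ?; apply: fM; lia.
apply: (runs_cut (T1 := 5) (T2 := (20 + (20 * n + 50) * size bl) + 50)
  (P := fun s2 => [/\ reg s2 rEU = e.1.1, reg s2 rLC = size l
                    & reg s2 rLP = (reg s1 rLP).+1])).
- by sexec entry_head; subst; rewrite /= addn1 Mu C subn1.
- lia.
move=> s2 [fr2 /(_ isT) fm2] [EU2 LC2 LP2].
apply: (runs_cut (scan_bundlesP (V := V) (U := e.1.1) (bl := bl) (n := n)
  _ _ _ _ _)) => //.
- by rewrite fr2.
- by rewrite fr2.
- by rewrite fr2 // fm2.
move=> s3 [fr3 /(_ isT) fm3] [C33 S3].
have LC3 : reg s3 rLC = size l by rewrite fr3.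
have LP3 : reg s3 rLP = (reg s1 rLP).+1 by rewrite fr3.
have M13 : reg s3 rM1 = reg s1 rM1 by rewrite fr3 // fr2.
rewrite -{}fm2 -{}fm3 in MA MB Mu M1 M2 fM.
set l0 := reg s1 rLP in P MA MB Mu M2 LP2 LP3.
apply: (runs_cut (T1 := 20) (T2 := 30) (P := fun s4 => [/\
    mem s4 = upd (upd (mem s3) l0.+1 e.2) l0.+2 (e.1.2 + single_cost bl V),
    reg s4 rLP = l0.+3, reg s4 rLB = e.2
    & reg s4 rX1 = e.1.2 + three_cost bl e.1.1 V])); [|lia|].
  sexec entry_swap; subst; rewrite /= !addn1 ?addn0 LP3 MA MB.
  by rewrite S3 C33.
move=> s4 [fr4 _] [fm4 LP4 LB4 X4].
have C34 : reg s4 rC3 = three_cost bl e.1.1 V by rewrite fr4.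
apply: runs_weaken (runs_frame (entry_minP X4 LB4 C34)) _ _ => // s5.
rewrite fr4 // M13 => -[M15 [fr5 /(_ isT) fm5]].
have code1 : entry_code (map (swap_entry bl V) (rcons done e)) =
  entry_code (map (swap_entry bl V) done) ++
  [:: e.1.1; e.2; e.1.2 + single_cost bl V].
  by rewrite map_rcons /entry_code map_rcons flatten_rcons.
have szm : size (entry_code (map (swap_entry bl V) done)) = size (entry_code done).
  by rewrite !size_entry_code size_map.
exists (rcons done e); split.
- by rewrite cat_rcons fr5 // fr4.
- rewrite fr5 // LP4 P !size_entry_code size_rcons; lia.
- rewrite fm5 fm4 code1 memat_cat szm -P fr5 // LP4; split; [split|].
  + by do 2 (apply: memat_upd; first by rewrite szm; lia).
  + split; first by rewrite !upd_ne ?Mu //; lia.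
    by split; [rewrite upd_ne ?upd_eq //; lia | rewrite /= upd_eq].
  + by do 2 (apply: memat_upd; first by lia).
- by move=> i ilt; rewrite fm5 fm4 !upd_ne; [exact: fM | lia | lia].
- by rewrite M15 B fr5 // fr4.
Qed.

Definition dp_head :=
  Next rV rVP ;; Decr rVC ;; Mov rLP rLS ;; Mov rLC rLN ;; Const rM1 0.
Definition dp_tail :=
  Push rLE rU ;; Push rLE rT ;; Add rX1 rT rS ;; Push rLE rX1 ;; Incr rLN ;;
  Mov rT rM1 ;; Decr rT ;; Mov rU rV.
Definition dp_body := dp_head ;; While rLC entry_body ;; dp_tail.

(** The table gains one entry per vertex, so [m] bounds its length throughout. It lies after the
    bundles and the path order, and can grow without overwriting them. *)
Lemma dp_loopP s bl n m L T U vs :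
  reg s rNB = size bl -> memat (mem s) (reg s rBP) (bundle_code bl) ->
  all (fun b => size b.2 <= n) bl ->
  reg s rBP + size (bundle_code bl) <= reg s rVP ->
  memat (mem s) (reg s rVP) vs -> reg s rVC = size vs ->
  reg s rVP + size vs <= reg s rLS ->
  memat (mem s) (reg s rLS) (entry_code L) ->
  reg s rLN = size L -> reg s rLE = reg s rLS + size (entry_code L) ->
  reg s rT = T -> reg s rU = U -> 0 < size L -> size L + size vs <= m ->
  runs (While rVC dp_body) s
    ((((20 * n + 50) * size bl + 100) * m + 50) * size vs).+1
    (fun s' => reg s' rT = dp bl L T U vs).
Proof.
move=> eNB Mb ab dis1 Mv eVC dis2 ML eLN eLE eT eU L0 Lm.
set t1 := (20 * n + 50) * size bl + 100.
(* The value of [dp] on the current table and the remaining vertices stays constant. *)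
pose I l s' := exists L' T' U', [/\ [/\ dp bl L' T' U' l = dp bl L T U vs,
   reg s' rVC = size l, reg s' rVP + size l = reg s rVP + size vs
   & reg s rVP <= reg s' rVP],
   [/\ reg s' rLN = size L', reg s' rLE = reg s rLS + size (entry_code L'),
     reg s' rT = T' & reg s' rU = U'],
   memat (mem s') (reg s' rVP) l, memat (mem s') (reg s rLS) (entry_code L')
   & [/\ forall i, i < reg s rLS -> mem s' i = mem s i, 0 < size L'
        & size L' + size l <= m]].
apply: (runs_while (T := t1 * m + 49) (I := I) (l := vs)).
- by exists L, T, U; split.
- by rewrite -addnS.
- by move=> s1 _ [L1 [T1 [U1 [[<- C _ _] [_ _ -> _] _ _ _]]]].
move=> v l s1 [fr1 _] [L1 [T1 [U1 [[Edp C P P'] [LN LE eT1 eU1]]]]].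
move=> [Mv1 Mv2] ML1 [fM L10 Lm1].
rewrite /= in C P Lm1; split; first by rewrite C.
have NB1 : reg s1 rNB = size bl by rewrite fr1.
have BP1 : reg s1 rBP = reg s rBP by rewrite fr1.
have LS1 : reg s1 rLS = reg s rLS by rewrite fr1.
have Mb1 : memat (mem s1) (reg s1 rBP) (bundle_code bl).
  by rewrite BP1; apply: memat_frame Mb => i ?; apply: fM; lia.
apply: (runs_cut (T1 := 10) (T2 := t1 * m + 1 + 25) (P := fun s2 =>
  [/\ [/\ reg s2 rV = v, reg s2 rVC = size l & reg s2 rVP = (reg s1 rVP).+1],
    reg s2 rLP = reg s rLS, reg s2 rLC = size L1 & reg s2 rM1 = 0])).
- by sexec dp_head; subst; rewrite /= !addn0 addn1 LS1 LN C subn1.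
- by lia.
move=> s2 [fr2 /(_ isT) fm2] [[V2 VC2 VP2] LP2 LC2 M12].
apply: (runs_cut (entry_loopP (V := v) (bl := bl) (n := n) (L := L1)
  _ _ _ _ _ _ _) (T2 := 25)) => //.
- by rewrite fr2.
- by rewrite fr2 // fm2.
- by rewrite fr2 // LP2 BP1; lia.
- by rewrite LP2 fm2.
- by rewrite -/t1; have := leq_mul (leqnn t1) (_ : size L1 <= m); lia.
move=> s3 [fr3 _] [M3 fM3 M13 /(_ L10) S3]; rewrite LP2 M12 fm2 in M3 fM3 M13.
apply: (runs_weaken (T := 25)) (leqnn _) (fun _ => id).
have [VC3 VP3] : reg s3 rVC = size l /\ reg s3 rVP = (reg s1 rVP).+1 by rewrite !fr3.
have [T3 U3] : reg s3 rT = T1 /\ reg s3 rU = U1 by rewrite !fr3 // !fr2.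
have [LE3 V3] : reg s3 rLE = reg s1 rLE /\ reg s3 rV = v.
  by rewrite (fr3 rLE) // (fr2 rLE) // fr3.
have LN3 : reg s3 rLN = size L1 by rewrite !fr3 // !fr2.
set L2 := rcons (map (swap_entry bl v) L1) (U1, T1, T1 + single_cost bl v).
have sL2 : size L2 = (size L1).+1 by rewrite size_rcons size_map.
have szL2 : size (entry_code L2) = size (entry_code L1) + 3.
  by rewrite !size_entry_code size_rcons size_map; lia.
have szm : size (entry_code (map (swap_entry bl v) L1)) = size (entry_code L1).
  by rewrite !size_entry_code size_map.
sexec dp_tail; subst_lhs; rewrite /I /= ?addn1 ?addn0 !subn1 T3 U3 V3 S3 M13 LE3 LN3 LE.
exists L2, (foldl (best_step bl v) 0 L1).-1, v; split => //=.
- by rewrite VC3 VP3; split => //; lia.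
- by rewrite sL2 szL2; split => //; lia.
- rewrite VP3; do 3 (apply: memat_upd; first by lia).
  by apply: memat_frame Mv2 => i ?; apply: fM3; lia.
- rewrite /L2 /entry_code map_rcons flatten_rcons -/(entry_code _) memat_cat szm; split.
    by do 3 (apply: memat_upd; first by rewrite szm; lia).
  split; first by rewrite upd_ne; [rewrite upd_ne ?upd_eq //; lia | lia].
  split; first by rewrite upd_ne ?upd_eq //; lia.
  by rewrite /= upd_eq.
split; rewrite ?sL2 //; last by lia.
by move=> i ?; rewrite !upd_ne ?fM3 ?fM //; lia.
Qed.

(** * Walking along the path, and the whole program *)

Definition edge_code (es : seq (nat * nat)) := flatten [seq [:: e.1; e.2] | e <- es].

Lemma size_edge_code es : size (edge_code es) = size es + size es.
Proof. by rewrite /edge_code; elim: es => //= e es ->; lia. Qed.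

Definition neighbor_step p c w (e : nat * nat) :=
  let w1 := if (e.1 == c) && (e.2 != p) then e.2 else w in
  if (e.2 == c) && (e.1 != p) then e.1 else w1.

(** The walk remembers the previous and the current vertex. The search starts from the current
    vertex itself, so an unchanged value signals a dead end, where the walk stays. *)
Definition walk_step es (pc : nat * nat) :=
  let w := foldl (neighbor_step pc.1 pc.2) pc.2 es in
  if w == pc.2 then pc else (pc.2, w).

Fixpoint trail es k pc :=
  if k is k'.+1 then pc.2 :: trail es k' (walk_step es pc) else [::].

Definition neighbor_body :=
  Next rA rEP ;; Next rB rEP ;; Decr rEC ;;
  IfEq rA rCur (IfEq rB rPrev Skip (Mov rNxt rB)) Skip ;;
  IfEq rB rCur (IfEq rA rPrev Skip (Mov rNxt rA)) Skip.

Lemma neighborP s es p c :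
  reg s rPrev = p -> reg s rCur = c -> memat (mem s) (reg s rEP) (edge_code es) ->
  reg s rEC = size es ->
  runs (While rEC neighbor_body) s (32 * size es).+1
    (fun s' => reg s' rNxt = foldl (neighbor_step p c) (reg s rNxt) es).
Proof.
move=> ep ec Me eEC.
pose I l s' := [/\ memat (mem s) (reg s' rEP) (edge_code l), reg s' rEC = size l
  & foldl (neighbor_step p c) (reg s' rNxt) l =
    foldl (neighbor_step p c) (reg s rNxt) es].
apply: (runs_while (T := 31) (I := I) (l := es)) => //; first by move=> s1 _ [].
move=> [a b] l s1 [fr1 /(_ isT) fm1] [/= [M1 [M2 Ml]] C F]; split; first by rewrite C.
have := fr1 rPrev isT; have := fr1 rCur isT; rewrite {}ec {}ep => ec ep.
rewrite -fm1 in M1 M2; rewrite /neighbor_step /= in F.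
sexec neighbor_body; rewrite /I /= ?addn0.
all: have e0 : v0 = (reg s1 rEP).+1 by arith.
all: have -> : v2 = (reg s1 rEP).+2 by arith.
all: have -> : v3 = size l by arith.
all: rewrite M1 in H; rewrite e0 M2 in H1.
all: split=> //; rewrite -F; congr foldl; rewrite -ec -ep; subst v v1.
all: repeat match goal with
  | H : (_ == _) = _ |- _ => rewrite ?H /=; clear H end.
all: by rewrite ?andbF; subst_lhs; rewrite ?addn0.
Qed.

(** The edges start at address 4, right after the header. *)
Definition walk_head :=
  Push rOut rCur ;; Decr rWC ;; Mov rNxt rCur ;; Const rEP 4 ;; Mov rEC rM.
Definition walk_move := IfEq rNxt rCur Skip (Mov rPrev rCur ;; Mov rCur rNxt).
Definition walk_body := walk_head ;; While rEC neighbor_body ;; walk_move.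
(** The label [n] is no vertex, so the first step excludes no neighbour. *)
Definition walk_init := Mov rPrev rN ;; Mov rOut rEnd ;; Mov rWC rN.
Definition walk := walk_init ;; While rWC walk_body.

Lemma trailS es k pc :
  trail es k.+1 pc = rcons (trail es k pc) (iter k (walk_step es) pc).2.
Proof.
elim: k pc => // k IH pc.
by rewrite iterSr (_ : trail _ _ _ = pc.2 :: trail es k.+1 (walk_step es pc)) // IH.
Qed.

Lemma size_trail es k pc : size (trail es k pc) = k.
Proof. by elim: k pc => //= k IH pc; rewrite IH. Qed.

(** Applied twice: the first walk serves for its final vertex; the second starts there and writes
    the path order over the output of the first. *)
Lemma walkP s es n v :
  reg s rN = n -> reg s rM = size es -> memat (mem s) 4 (edge_code es) ->
  4 + size (edge_code es) <= reg s rEnd -> reg s rCur = v ->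
  runs walk s (10 + (32 * size es + 50) * n) (fun s' =>
    [/\ reg s' rCur = (iter n (walk_step es) (n, v)).2,
        memat (mem s') (reg s rEnd) (trail es n (n, v)),
        forall i, i < reg s rEnd -> mem s' i = mem s i
      & reg s' rOut = reg s rEnd + n]).
Proof.
move=> eN eM Me dis ev.
apply: (runs_cut (T1 := 6) (T2 := ((32 * size es + 49).+1 * n).+1) (P := fun s1 =>
  [/\ reg s1 rPrev = n, reg s1 rOut = reg s rEnd, reg s1 rWC = n & mem s1 = mem s])).
- by sexec walk_init; subst_lhs; rewrite /= !addn0.
- by rewrite -addnS; lia.
move=> s1 [fr1 _] [p1 o1 c1 m1].
pose I (l : seq nat) s' := exists k pc, [/\ reg s' rWC = size l /\ k + size l = n,
  (reg s' rPrev, reg s' rCur) = pc /\ iter k (walk_step es) (n, v) = pc,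
  memat (mem s') (reg s rEnd) (trail es k (n, v)),
  forall i, i < reg s rEnd -> mem s' i = mem s i
  & reg s' rOut = reg s rEnd + k].
apply: (runs_while (T := 32 * size es + 49) (I := I) (l := nseq n 0)).
- exists 0, (n, v); rewrite size_nseq; split => //=.
  + by rewrite p1 fr1 // ev.
  + by move=> i _; rewrite m1.
  + by rewrite o1 addn0.
- by rewrite size_nseq.
- move=> s2 _ [k [pc [[-> kn] [<- epc] Ms fs o2]]]; split => //.
  rewrite /= addn0 in kn; subst k; split => //.
  by rewrite epc.
move=> x l s2 [fr2 _] [k [pc [[C kn] [Epc epc] M2 f2 o2]]].
rewrite /= in C kn; split; first by rewrite C.
have [p2 u2] : reg s2 rPrev = pc.1 /\ reg s2 rCur = pc.2 by rewrite -Epc.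
clear Epc.
have [N2 End2] : reg s2 rM = size es /\ reg s2 rEnd = reg s rEnd by rewrite !fr2 // !fr1.
apply: (runs_cut (T1 := 10) (T2 := (32 * size es).+1 + 20) (P := fun s3 =>
  [/\ [/\ mem s3 = upd (mem s2) (reg s rEnd + k) pc.2, reg s3 rOut = reg s rEnd + k.+1 &
    reg s3 rWC = size l], reg s3 rNxt = pc.2, reg s3 rEP = 4 & reg s3 rEC = size es])).
- by sexec walk_head; subst_lhs; rewrite /= !addn0 u2 o2 addn1 addnS C subn1 N2.
- lia.
move=> s3 [fr3 _] [[m3 o3 c3] nx3 ep3 ec3].
have p3 : reg s3 rPrev = pc.1 by rewrite fr3.
have u3 : reg s3 rCur = pc.2 by rewrite fr3.
apply: (runs_cut (neighborP p3 u3 (es := es) _ _)) => //.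
  rewrite ep3 m3; apply: memat_upd; first by right; lia.
  by apply: memat_frame Me => i ?; apply: f2; lia.
move=> s4 [fr4 /(_ isT) m4]; rewrite nx3 => nx4.
have p4 : reg s4 rPrev = pc.1 by rewrite fr4.
have u4 : reg s4 rCur = pc.2 by rewrite fr4.
have c4 : reg s4 rWC = size l by rewrite fr4.
have o4 : reg s4 rOut = reg s rEnd + k.+1 by rewrite fr4.
have Ik pc' R : pc' = walk_step es pc -> (R rPrev, R rCur) = pc' ->
    R rWC = reg s4 rWC -> R rOut = reg s4 rOut -> I l (State R (mem s4)).
  move=> E1 E2 E3 E4; exists k.+1, pc'; split; cbn [reg mem].
  - by rewrite E3; split; [|lia].
  - by rewrite E2 E1 -epc.
  - rewrite trailS m4 m3 -cats1 memat_cat size_trail epc.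
    split; first by apply: memat_upd => //; rewrite size_trail; lia.
    by rewrite /= upd_eq.
  - by move=> i ?; rewrite m4 m3 upd_ne ?f2 //; lia.
  - by rewrite E4.
sexec walk_move; apply: Ik => //=; rewrite /walk_step -nx4 -u4.
- by rewrite E; subst_lhs; rewrite !addn0.
- by rewrite E p4 u4 -surjective_pairing.
Qed.

(** * The whole program and its time bound *)

Definition header :=
  Const rEP 0 ;; Next rN rEP ;; Next rM rEP ;; Next rNB rEP ;; Next rBud rEP ;;
  Add rBP rEP rM ;; Add rBP rBP rM ;; Mov rEnd rBP ;; Mov rPC rNB ;;
  Const rK 0 ;; Const rCur 0.
(** This pass also locates the end of the bundles, which the header does not give. *)
Definition base_body :=
  Next rW rEnd ;; Next rSz rEnd ;; Add rEnd rEnd rSz ;; Decr rPC ;;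
  Add rK rK rW ;; Decr rSz ;; If rSz (Add rK rK rW) Skip.
(** The initial table makes the empty prefix free, whatever the colour of the missing vertex. *)
Definition dp_init :=
  Push rOut rN ;; Push rOut rN ;; Mov rLS rOut ;; Push rOut rN ;; Const rT 0 ;;
  Push rOut rT ;; Push rOut rT ;; Mov rLE rOut ;; Const rLN 1 ;; Mov rU rN ;;
  Mov rVP rEnd ;; Mov rVC rN ;; Incr rVC ;; Incr rVC.
(** The truncated difference between the budget plus one and the cost is positive exactly when the
    cost is within the budget. *)
Definition final := Add 1 rK rT ;; Incr rBud ;; Sub 0 rBud 1.
(* The label [n], which is in no bundle, stands for the missing vertex before the
   path, and is appended twice after it: these two free vertices can always be
   coloured so that the last one gets 3, so that the optimum ends up in [rT]. *)
Definition program :=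
  header ;; While rPC base_body ;; walk ;; walk ;; dp_init ;; While rVC dp_body ;;
  final.

Lemma baseP s bl :
  memat (mem s) (reg s rEnd) (bundle_code bl) -> reg s rPC = size bl ->
  runs (While rPC base_body) s (20 * size bl).+1 (fun s' =>
    reg s' rK = reg s rK + base_cost bl /\
    reg s' rEnd = reg s rEnd + size (bundle_code bl)).
Proof.
move=> Mb C.
pose I l s' := [/\ memat (mem s) (reg s' rEnd) (bundle_code l),
  reg s' rPC = size l, reg s' rK + base_cost l = reg s rK + base_cost bl
  & reg s' rEnd + size (bundle_code l) = reg s rEnd + size (bundle_code bl)].
apply: (runs_while (T := 19) (I := I) (l := bl)) => //.
  by move=> s1 _ [_ C1 <- <-]; rewrite /base_cost big_nil !addn0.
move=> b l s1 [fr1 /(_ isT) m1] [/= [M1 [M2 /memat_cat[_ M3]]] C1 K E].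
split; first by rewrite C1.
rewrite size_cat -/(bundle_code l) in E; rewrite /base_cost big_cons in K.
rewrite -m1 in M1 M2.
sexec base_body; rewrite /I /=.
all: have e0 : v0 = (reg s1 rEnd).+1 by arith.
all: have e3 : v3 = (reg s1 rEnd).+2 + size b.2 by rewrite e0 M2 in H1; arith.
all: rewrite e0 M2 in H1; rewrite M1 in H.
all: have e4 : v4 = size l by arith.
all: rewrite e3 e4; split=> //; last by arith.
all: rewrite -K /base_cost; subst_lhs.
- by rewrite (_ : 1 < size b.2) ?muln2; lia.
- by rewrite (_ : 1 < size b.2 = false) ?muln1; lia.
Qed.

Lemma programP n es bl bud
    (x := [:: n; size es; size bl; bud] ++ edge_code es ++ bundle_code bl) :
  0 < n -> size es <= n * n -> 0 < size bl -> all (fun b => size b.2 <= n) bl ->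
  let v := (iter n (walk_step es) (n, 0)).2 in
  runs program (init x) (3000 * (n ^ 3 * size bl)) (fun s =>
    reg s 1 = base_cost bl +
      dp bl [:: (n, 0, 0)] 0 n (trail es n (n, v) ++ [:: n; n]) /\
    reg s 0 = bud.+1 - reg s 1).
Proof.
move=> n0 esn bl0 ab v.
have Mx : memat (mem (init x)) 0 x by apply: memat_nth => i; rewrite add0n.
move: (init x) Mx => s0; rewrite {}/x.
move=> /memat_cat[[/= x0 [x1 [x2 [x3 _]]]] /memat_cat[Me Mb]].
rewrite size_edge_code !add0n in Me Mb.
pose tw := 10 + (32 * size es + 50) * n.
pose td := ((((20 * n + 50) * size bl + 100) * (n + 3) + 50) * (n + 2)).+1.
apply: (@runs_weaken _ _
  (30 + ((20 * size bl).+1 + (tw + (tw + (40 + (td + 10)))))) _ _ _ _ _ (fun _ => id)).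
all: cycle 1.
  (* As [n] and [size bl] are positive and [size es <= n * n], every term of the total is bounded by
     a multiple of [n * n * n * size bl]. The cubic term of [td] is path length times table length
     times the scan of all bundles. *)
  have b1 : n * n * n <= n * n * n * size bl by rewrite leq_pmulr.
  have b2 : n * n <= n * n * n by rewrite leq_pmulr.
  have b3 : n <= n * n by rewrite leq_pmulr.
  have b4 : size bl <= n * size bl by rewrite leq_pmull.
  have b5 : n * size bl <= n * n * size bl by rewrite -mulnA leq_pmull.
  have b6 : n * n * size bl <= n * n * n * size bl by rewrite leq_mul2r b2 orbT.
  have b7 : size es * n <= n * n * n by rewrite leq_mul2r esn orbT.
  by rewrite /tw /td (_ : n ^ 3 = n * n * n) ?expnS ?expn0; lia.
apply: (runs_cut (T1 := 30) (P := fun s => [/\ [/\ reg s rN = n, reg s rM = size es,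
  reg s rNB = size bl & reg s rBud = bud], reg s rBP = 4 + (size es + size es),
  reg s rEnd = 4 + (size es + size es) /\ reg s rPC = size bl, reg s rK = 0
  & reg s rCur = 0])) => //.
  by sexec header; subst_lhs; rewrite /= ?addn1 ?addn0 x0 x1 x2 x3 addnA.
move=> s1 [_ /(_ isT) m1] [[N1 M1 NB1 Bud1] BP1 [End1 PC1] K1 Cur1].
set B0 := 4 + _ in Mb BP1 End1; rewrite -{}m1 in Me Mb.
apply: (runs_cut (baseP (bl := bl) _ PC1)) => //; first by rewrite End1.
move=> s2 [fr2 /(_ isT) m2] []; rewrite K1 End1 add0n => K2 End2.
rewrite -{}m2 in Me Mb.
apply: (runs_cut (walkP (n := n) (es := es) (v := 0) _ _ Me _ _)) => //; try by rewrite fr2.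
  by rewrite End2 /B0 size_edge_code; lia.
move=> s3 [fr3 _] [Cur3 _ f3 _]; rewrite End2 in f3.
have Me3 : memat (mem s3) 4 (edge_code es).
  by apply: memat_frame Me; rewrite size_edge_code => i ?; apply: f3; lia.
have Mb3 : memat (mem s3) B0 (bundle_code bl).
  by apply: memat_frame Mb => i ?; apply: f3; lia.
have End3 : reg s3 rEnd = B0 + size (bundle_code bl) by rewrite fr3.
apply: (runs_cut (walkP (n := n) (es := es) (v := v) _ _ Me3 _ Cur3)) => //;
  try by rewrite fr3 // fr2.
  by rewrite End3 /B0 size_edge_code; lia.
move=> s4 [fr4 _] [_ Ms4 f4 O4]; rewrite End3 in Ms4 f4 O4.
have Mb4 : memat (mem s4) B0 (bundle_code bl).
  by apply: memat_frame Mb3 => i ?; apply: f4; lia.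
have N4 : reg s4 rN = n by rewrite fr4 // fr3 // fr2.
have End4 : reg s4 rEnd = B0 + size (bundle_code bl) by rewrite fr4.
set a := B0 + _ in Ms4 f4 O4 End4.
apply: (runs_cut (T1 := 40) (P := fun s => [/\ 
  [/\ reg s rLS = a + n.+2, reg s rLE = a + n.+2 + 3, reg s rLN = 1, reg s rT = 0
    & reg s rU = n],
  reg s rVP = a, reg s rVC = n.+2,
  memat (mem s) a (trail es n (n, v) ++ [:: n; n]) /\
  memat (mem s) (a + n.+2) [:: n; 0; 0] &
  forall i, i < a -> mem s i = mem s4 i])) => //.
  have Ea i : a + n.+2 + i = (a + n + i).+2 by lia.
  sexec dp_init; subst_lhs; rewrite /= N4 O4 End4 ?addn1 ?addn0 !addnS !addn0 ?addn1.
  split=> //; last by move=> i ?; lookup.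
  rewrite memat_cat size_trail /=.
  split; [split; [|by split; [lookup|split; [lookup|]]]|].
    by do 5 (apply: memat_upd; first by rewrite size_trail; lia).
  by split; [lookup|split; [lookup|split; [lookup|]]].
move=> s5 [fr5 _] [[LS5 LE5 LN5 T5 U5] VP5 VC5 [Mv5 Ml5] f5].
have Mb5 : memat (mem s5) (reg s5 rBP) (bundle_code bl).
  rewrite !(fr5, fr4, fr3, fr2) // BP1 -/B0.
  by apply: memat_frame Mb4 => i ?; apply: f5; lia.
have BP5 : reg s5 rBP = B0 by rewrite !(fr5, fr4, fr3, fr2).
apply: (runs_cut (dp_loopP (s := s5) (bl := bl) (n := n) (m := n + 3)
  (L := [:: (n, 0, 0)]) (vs := trail es n (n, v) ++ [:: n; n]) (T := 0) (U := n)
  _ _ _ _ _ _ _ _ _ _ _ _ _ _)) => //.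
- by rewrite !(fr5, fr4, fr3, fr2).
- by rewrite BP5 VP5.
- by rewrite VP5.
- by rewrite VC5 size_cat size_trail addn2.
- by rewrite VP5 LS5 size_cat size_trail /=; lia.
- by rewrite LS5.
- by rewrite LE5 LS5.
- by rewrite size_cat size_trail /=; lia.
- by rewrite size_cat size_trail /td.
move=> s6 [fr6 _] T6.
have [K6 Bud6] : reg s6 rK = base_cost bl /\ reg s6 rBud = bud.
  by rewrite !(fr6, fr5, fr4, fr3) // K2 fr2.
by sexec final; subst_lhs; rewrite /= T6 K6 ?Bud6 ?addn1.
Qed.

(** * Correctness of the recurrence *)

Definition palette (x : nat) := 0 < x <= 3.
Definition differ : rel nat := fun x y => x != y.

Definition penalty bl u v x :=
  if x == 3 then three_cost bl u v else if x == 2 then single_cost bl v else 0.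
Definition last_three (u v x : nat) := if x == 3 then v else u.

Fixpoint path_cost bl u vs xs :=
  match vs, xs with
  | v :: vs', x :: xs' =>
      penalty bl u v x + path_cost bl (last_three u v x) vs' xs'
  | _, _ => 0
  end.

(* [val] is the table's cost for a prefix with last colour [p] and last vertex
   coloured 3 [u]. *)
Definition table_value (L : seq (nat * nat * nat)) (T u0 p u val : nat) :=
  [\/ p = 1 /\ exists B, (u, val, B) \in L,
      p = 2 /\ exists A, (u, A, val) \in L
    | [/\ p = 3, u = u0 & val = T]].

Lemma best_step_gt0 bl v m e : 0 < best_step bl v m e.
Proof. by rewrite /best_step /upmin; case: ifP => // /norP[]; lia. Qed.

Lemma best_step_le bl v m e :
  [/\ 0 < m -> best_step bl v m e <= m,
    best_step bl v m e <= (e.1.2 + three_cost bl e.1.1 v).+1 &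
    best_step bl v m e <= (e.2 + three_cost bl e.1.1 v).+1].
Proof. by rewrite /best_step /upmin; split; do !case: ifP; lia. Qed.

Lemma best_step_in bl v m e :
  [\/ best_step bl v m e = m, best_step bl v m e = (e.1.2 + three_cost bl e.1.1 v).+1 |
    best_step bl v m e = (e.2 + three_cost bl e.1.1 v).+1].
Proof.
rewrite /best_step /upmin; case: ifP => _; first by constructor 3.
by case: ifP => _; [constructor 2 | constructor 1].
Qed.

Lemma best_le bl v m L :
  (0 < m -> 0 < foldl (best_step bl v) m L <= m) /\
  forall e, e \in L ->
    foldl (best_step bl v) m L <= (e.1.2 + three_cost bl e.1.1 v).+1 /\
    foldl (best_step bl v) m L <= (e.2 + three_cost bl e.1.1 v).+1.
Proof.
elim: L m => [|e L IH] m /=; first by split => // ->; rewrite /=.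
have [/(_ (best_step_gt0 bl v m e)) /andP[r0 rle] rL] := IH (best_step bl v m e).
have [le0 le1 le2] := best_step_le bl v m e.
split=> [m0|e']; first by rewrite r0 (leq_trans rle) ?le0.
by rewrite inE => /orP[/eqP->|/rL //]; split; apply: leq_trans rle _.
Qed.

Lemma best_in bl v m L :
  foldl (best_step bl v) m L = m \/
  exists e, e \in L /\
    (foldl (best_step bl v) m L = (e.1.2 + three_cost bl e.1.1 v).+1 \/
     foldl (best_step bl v) m L = (e.2 + three_cost bl e.1.1 v).+1).
Proof.
elim: L m => [|e L IH] m /=; first by left.
have [->|[e' [e'L E]]] := IH (best_step bl v m e); last first.
  by right; exists e'; rewrite inE e'L orbT.
case: (best_step_in bl v m e) => ->; first by left.
  by right; exists e; rewrite mem_head; split; [|left].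
by right; exists e; rewrite mem_head; split; [|right].
Qed.

Lemma best_gt0 bl v L : 0 < size L -> 0 < foldl (best_step bl v) 0 L.
Proof.
case: L => //= e L _.
by have [/(_ (best_step_gt0 bl v 0 e)) /andP[]] := best_le bl v (best_step bl v 0 e) L.
Qed.

Section Step.
Variables (bl : seq (nat * seq nat)) (L : seq (nat * nat * nat)) (T u0 v : nat).
Hypothesis L0 : 0 < size L.
Let L' := rcons (map (swap_entry bl v) L) (u0, T, T + single_cost bl v).
Let T' := (foldl (best_step bl v) 0 L).-1.

(** Only an inequality, because for colour 3 the table keeps just the best predecessor. *)
Lemma table_step p u val x : palette x -> differ p x -> table_value L T u0 p u val ->
  exists2 val', val' <= val + penalty bl u v x &
    table_value L' T' v x (last_three u v x) val'.
Proof.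
have inL e : e \in L -> swap_entry bl v e \in L'.
  by move=> eL; rewrite mem_rcons inE map_f ?orbT.
have newL : (u0, T, T + single_cost bl v) \in L' by rewrite mem_rcons mem_head.
have r0 := best_gt0 bl v L0; have [_ rle] := best_le bl v 0 L.
have x3 : palette x -> x = 1 \/ x = 2 \/ x = 3 by rewrite /palette; lia.
rewrite /penalty /last_three /differ => /x3[->|[->|->]] /= px;
  case=> [[pE [B BL]]|[pE [A AL]]|[pE -> ->]]; subst p => //=.
- exists val; first by lia.
  by constructor 1; split => //; eexists; apply: inL AL.
- by exists T; [lia|constructor 1; split => //; eexists; apply: newL].
- exists (val + single_cost bl v) => //.
  by constructor 2; split => //; eexists; apply: inL BL.
- by exists (T + single_cost bl v) => //; constructor 2; split => //; eexists; apply: newL.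
- by exists T'; [rewrite -ltnS prednK //; have [] := rle _ BL|constructor 3].
- by exists T'; [rewrite -ltnS prednK //; have [] := rle _ AL|constructor 3].
Qed.

(** The converse, with equality: every value in the new table comes from an actual extension, so the
    table never undercuts the true costs. *)
Lemma table_step_inv x u' val' : table_value L' T' v x u' val' ->
  exists p u val, [/\ table_value L T u0 p u val, palette x, differ p x,
    u' = last_three u v x & val' = val + penalty bl u v x].
Proof.
have r0 := best_gt0 bl v L0.
rewrite /penalty /last_three /differ.
case=> [[-> [B]]|[-> [A]]|[-> -> ->]] /=.
- rewrite mem_rcons inE => /orP[/eqP[-> -> _]|/mapP[[[u A0] B0] eL [-> -> _]]].
    by exists 3, u0, T; split; rewrite ?addn0 //; constructor 3.
  by exists 2, u, B0; split; rewrite ?addn0 //; constructor 2; split => //; exists A0.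
- rewrite mem_rcons inE => /orP[/eqP[-> _ ->]|/mapP[[[u A0] B0] eL [-> _ ->]]].
    by exists 3, u0, T; split => //; constructor 3.
  by exists 1, u, A0; split => //; constructor 1; split => //; exists B0.
case: (best_in bl v 0 L) => [r|[[[u A0] B0] [eL [/= r|/= r]]]].
    by rewrite r in r0.
  exists 1, u, A0; split; rewrite /T' ?r //.
  by constructor 1; split => //; exists B0.
exists 2, u, B0; split; rewrite /T' ?r //.
by constructor 2; split => //; exists A0.
Qed.
End Step.

(** The last colour has to be 3 because [dp] returns the final [T], which covers such colourings
    only. *)
Lemma dp_lower bl vs L T u0 xs p u val :
  0 < size L -> table_value L T u0 p u val -> size xs = size vs ->
  path differ p xs -> all palette xs -> last p xs = 3 ->
  dp bl L T u0 vs <= val + path_cost bl u vs xs.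
Proof.
elim: vs L T u0 xs p u val => [|v vs IH] L T u0 [|x xs] p u val L0 tv //=.
  by move=> _ _ _ p3; case: tv => [[]|[]|[_ _ ->]]; lia.
move=> [sz] /andP[px pxs] /andP[cx cxs] lst.
have [val' le' tv'] := table_step bl v L0 cx px tv.
apply: leq_trans (IH _ _ _ _ _ _ _ _ tv' sz pxs cxs lst) _; last by lia.
by rewrite size_rcons.
Qed.

(** Induction on the table after [v] yields the colours of [v] and of the later vertices;
    [table_step_inv] traces the value used back to the table before [v]. *)
Lemma dp_achieved bl vs L T u0 : 0 < size L ->
  exists p u val xs, [/\ table_value L T u0 p u val, size xs = size vs,
    path differ p xs /\ all palette xs, last p xs = 3
    & dp bl L T u0 vs = val + path_cost bl u vs xs].
Proof.
elim: vs L T u0 => [|v vs IH] L T u0 L0 /=.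
  by exists 3, u0, T, [::]; split; rewrite /= ?addn0 //; constructor 3.
set L' := rcons _ _; set T' := _.-1.
have [|x [u' [val' [xs [tv sz [px cx] lst ->]]]]] := IH L' T' v; first by rewrite size_rcons.
have [p [u [val [tv' cx' dx -> ->]]]] := table_step_inv L0 tv.
exists p, u, val, (x :: xs); split => //=; [by rewrite sz| |by rewrite addnA].
by rewrite dx px cx' cx.
Qed.

Definition colors_path ys := sorted differ ys && all palette ys.

(** [u'] stays existential: the second part will consist of sentinels, which cost nothing from any
    [u']. *)
Lemma path_cost_cat bl u ws vs ys xs : size ys = size ws ->
  exists u', path_cost bl u (ws ++ vs) (ys ++ xs) =
    path_cost bl u ws ys + path_cost bl u' vs xs.
Proof.
elim: ws ys u => [|w ws IH] [|y ys] u //=; first by exists u.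
by case=> sz; have [u' E] := IH ys (last_three u w y) sz; exists u'; rewrite E addnA.
Qed.

(** * The missing vertex before the path and the free ones after it *)

Section Sentinel.
Variables (bl : seq (nat * seq nat)) (n : nat) (ws : seq nat).
Hypothesis nbl : forall b, b \in bl -> n \notin b.2.

Lemma single_cost_sentinel : single_cost bl n = 0.
Proof.
by rewrite /single_cost big_seq big1 // => b /nbl /negbTE nb; rewrite /alone nb muln0.
Qed.

Lemma three_cost_sentinel u : three_cost bl u n = 0.
Proof.
by rewrite /three_cost big_seq big1 // => b /nbl /negbTE nb; rewrite /alone nb muln0.
Qed.

Lemma path_cost_sentinel u xs : path_cost bl u [:: n; n] xs = 0.
Proof.
have p0 u' x : penalty bl u' n x = 0.
  by rewrite /penalty single_cost_sentinel three_cost_sentinel !if_same.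
by case: xs => [|x [|y xs]] //=; rewrite !p0.
Qed.

Let D := dp bl [:: (n, 0, 0)] 0 n (ws ++ [:: n; n]).

Lemma dp_min_lower ys : 0 < size ws -> size ys = size ws -> colors_path ys ->
  D <= path_cost bl n ws ys.
Proof.
move=> w0 sz /andP[]; case: ys sz => [|y ys] sz; first by rewrite -sz in w0.
move=> /= sy cy.
(* [q] separates the last colour from the final 3, and [p] colours the missing vertex; both possible
   values of [p] cost 0 in the initial table. *)
pose q := if last y ys == 1 then 2 else 1.
pose p := if y == 1 then 2 else 1.
have [u' E] := path_cost_cat bl n [:: n; n] [:: q; 3] sz.
rewrite -[X in _ <= X]addn0 -(path_cost_sentinel u' [:: q; 3]) -E.
apply: (@dp_lower _ _ _ _ _ (y :: ys ++ [:: q; 3]) p n 0) => //=.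
- rewrite /p; case: ifP => _; [constructor 2|constructor 1]; split => //; exists 0;
    exact: mem_head.
- by rewrite !size_cat /= -sz.
- have d1 : differ p y by rewrite /differ /p; case: ifP => /eqP; lia.
  have d2 : differ (last y ys) q by rewrite /differ /q; case: ifP => /eqP; lia.
  have d3 : differ q 3 by rewrite /differ /q; case: ifP.
  by rewrite cat_path sy /= d1 d2 d3.
- have q3 : palette q by rewrite /q; case: ifP.
  by move: cy => /= /andP[-> cy]; rewrite all_cat cy /= q3.
- by rewrite last_cat.
Qed.

Lemma dp_min_achieved : 0 < size ws ->
  exists ys, [/\ size ys = size ws, colors_path ys & D = path_cost bl n ws ys].
Proof.
move=> w0.
have [|p [u [val [xs [tv sz [px cx] _ DE]]]]] :=
  @dp_achieved bl (ws ++ [:: n; n]) [:: (n, 0, 0)] 0 n; first by [].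
have [u0 v0] : u = n /\ val = 0.
  by case: tv => [[_ [B]]|[_ [A]]|[_ -> ->]] //;
    rewrite inE => /eqP[]; [move=> -> -> _|move=> -> _ ->].
exists (take (size ws) xs).
have szt : size (take (size ws) xs) = size ws.
  by rewrite size_takel // sz size_cat leq_addr.
split=> //.
  rewrite /colors_path -(cat_take_drop (size ws) xs) in px cx *.
  rewrite take_size_cat //; move: px cx; rewrite cat_path all_cat.
  by move=> /andP[/path_sorted-> _] /andP[-> _].
have [u' E] := path_cost_cat bl n [:: n; n] (drop (size ws) xs) szt.
by rewrite /D DE u0 v0 -{1}(cat_take_drop (size ws) xs) E path_cost_sentinel addn0.
Qed.
End Sentinel.

(** * Cost of a colouring along the path *)

Section Convex.
Variables (V : eqType) (a : pred V).

Fixpoint prefixed o :=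
  if o is v :: o' then (if a v then prefixed o' else ~~ has a o') else true.
(** The members of [a] are consecutive in [o]; the one-pass form matches the recursion of
    [threes]. *)
Fixpoint convex o :=
  if o is v :: o' then (if a v then prefixed o' else convex o') else true.

Lemma convex_of_no o : ~~ has a o -> convex o.
Proof. by elim: o => //= v o IH /norP[/negbTE-> /IH]. Qed.

Lemma prefixed_convex o : prefixed o -> convex o.
Proof. by case: o => //= v o; case: ifP => // _ /convex_of_no. Qed.

Lemma convexP (s : V -> nat) o : sorted ltn (map s o) ->
  (forall x y z, x \in o -> y \in o -> z \in o -> s x < s y < s z ->
     a x -> a z -> a y) -> convex o.
Proof.
have tr : transitive (relpre s ltn) by move=> x y z; exact: ltn_trans.
have pre o' : sorted ltn (map s o') ->
  (forall y z, y \in o' -> z \in o' -> s y < s z -> a z -> a y) -> prefixed o'.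
  elim: o' => //= v o' IH => so H.
  have := so; rewrite path_map path_sortedE // => /andP[/allP vlt _].
  case: ifPn => [_|nav].
    apply: IH; first exact: path_sorted so.
    by move=> y z yo zo; apply: H; rewrite inE ?yo ?zo orbT.
  apply/hasPn => z zo; apply: contra nav => az; apply: (H v z) => //.
  - exact: mem_head.
  - by rewrite inE zo orbT.
  - exact: vlt.
elim: o => //= v o IH so H.
have := so; rewrite path_map path_sortedE // => /andP[/allP vlt _].
have so' : sorted ltn (map s o) by exact: path_sorted so.
case: ifPn => [av|_]; last first.
  by apply: IH => // x y z xo yo zo; apply: H; rewrite inE ?xo ?yo ?zo orbT.
apply: pre => // y z yo zo yz az; apply: (H v y z) => //.
- exact: mem_head.
- by rewrite inE yo orbT.
- by rewrite inE zo orbT.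
- by rewrite yz andbT; exact: vlt.
Qed.

(* [i] tells whether the previous vertex coloured 3 is in the bundle [a]. *)
Fixpoint threes (c : V -> nat) i o :=
  if o is v :: o' then
    if c v == 3 then (a v && ~~ i) + threes c (a v) o' else threes c i o'
  else 0.

Lemma threes_no c i o : ~~ has a o -> threes c i o = 0.
Proof.
by elim: o i => //= v o IH i /norP[/negbTE-> no]; rewrite !IH // if_same.
Qed.

Lemma threes_prefixed c o : prefixed o -> threes c true o = 0.
Proof.
elim: o => //= v o IH; case: ifP => _ po; first by rewrite IH // if_same.
by rewrite !threes_no // if_same.
Qed.

(** The members form one block: after its first 3 the flag stays true within the block, and beyond
    the block nothing can be charged. *)
Lemma threes_convex c o : convex o ->
  threes c false o = has (fun v => a v && (c v == 3)) o.
Proof.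
elim: o => //= v o IH; case: ifP => _ cv /=.
  by rewrite threes_prefixed // IH ?prefixed_convex //; case: eqP.
by rewrite IH // if_same.
Qed.
End Convex.

Lemma eq_convex (V : eqType) (a a' : pred V) o : a =1 a' -> convex a o = convex a' o.
Proof.
move=> aa'; elim: o => //= v o ->; rewrite aa'; case: ifP => // _.
by elim: o => //= w o ->; rewrite aa' (eq_has aa').
Qed.

Lemma penalty_sum bl u v x :
  penalty bl u v x = \sum_(b <- bl) b.1 * penalty [:: (1, b.2)] u v x.
Proof.
rewrite /penalty /three_cost /single_cost; case: eqP => _; last case: eqP => _.
- by apply: eq_bigr => b _; rewrite big_seq1 mul1n.
- by apply: eq_bigr => b _; rewrite big_seq1 mul1n.
- by rewrite big1 // => b _; rewrite muln0.
Qed.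

(** Linearity in the weights reduces the cost formula to a single bundle of weight 1. *)
Lemma path_cost_sum bl u ws ys :
  path_cost bl u ws ys = \sum_(b <- bl) b.1 * path_cost [:: (1, b.2)] u ws ys.
Proof.
elim: ws ys u => [|w ws IH] [|y ys] u /=; try by rewrite big1 // => b _; rewrite muln0.
by rewrite IH penalty_sum -big_split; apply: eq_bigr => b _; rewrite mulnDr.
Qed.

(** Colours 2 and 3 both pay one unit through [alone]; the other unit of colour 3 is the one counted
    by [threes]. *)
Lemma path_cost_threes n (o : seq 'I_n) (B : seq nat) (c : 'I_n -> nat) u :
  {in o, forall v, palette (c v)} ->
  path_cost [:: (1, B)] u (map val o) (map c o) =
    threes (fun v : 'I_n => val v \in B) c (u \in B) o +
    \sum_(v <- o) alone (val v) (1, B) * (1 < c v).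
Proof.
elim: o u => [|v o IH] u /= pc; first by rewrite big_nil.
rewrite IH; last by move=> w wo; apply: pc; rewrite inE wo orbT.
rewrite big_cons /penalty /last_three /three_cost /single_cost !big_seq1 !mul1n.
have : palette (c v) by apply: pc; exact: mem_head.
rewrite /palette; case: (c v) => [|[|[|[|]]]] //= _.
all: by rewrite ?muln0 ?muln1; lia.
Qed.

Lemma bundle_max n (o b : seq 'I_n) (c : 'I_n -> nat) (e : rel 'I_n) :
  (forall v, palette (c v)) -> (forall u v, e u v -> c u <> c v) ->
  uniq o -> o =i predT -> uniq b -> 0 < size b -> convex (fun v => v \in b) o ->
  (1 < size b -> exists u v, [/\ u \in b, v \in b & e u v]) ->
  \max_(v in [set v in b]) c v =
    (1 < size (map val b)).+1 + path_cost [:: (1, map val b)] n (map val o) (map c o).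
Proof.
move=> pc cp uo ao ub b0 cb eb.
have bE (v : 'I_n) : (val v \in map val b) = (v \in b) by rewrite mem_map //; exact: val_inj.
rewrite path_cost_threes // size_map.
(* No vertex coloured 3 precedes the path, so the flag starts at [false]. *)
have -> : (n \in map val b) = false.
  by apply/negP => /mapP[[v vn] _ /= E]; rewrite -E ltnn in vn.
have -> : threes (fun v : 'I_n => val v \in map val b) c false o =
  has (fun v => (v \in b) && (c v == 3)) o.
  rewrite -(threes_convex c cb); elim: (o) (false) => //= v o' IH i.
  by rewrite !IH bE.
have le3 : \max_(v in [set v in b]) c v <= 3.
  by apply/bigmax_leqP => v _; case/andP: (pc v).
have le_max v : v \in b -> c v <= \max_(v in [set v in b]) c v.
  by move=> vb; apply: leq_bigmax_cond; rewrite inE.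
have [b1|b2] := leqP (size b) 1.
  (* For a singleton the claim amounts to [c v = 1 + (c v == 3) + (1 < c v)]. *)
  case: b => [|v [|w b]] // in ub b0 cb eb bE b1 le3 le_max *.
  have -> : \max_(w in [set w in [:: v]]) c w = c v.
    by rewrite (big_pred1 v) // => w; rewrite !inE.
  rewrite (bigD1_seq v) ?ao //= big1_seq ?addn0; last first.
    by move=> w /andP[wv _]; rewrite /alone bE inE (negbTE wv).
  rewrite /alone bE mem_head /=.
  have -> : has (fun w => (w \in [:: v]) && (c w == 3)) o = (c v == 3).
    apply/hasP/idP => [[w _]|cv]; first by rewrite inE => /andP[/eqP->].
    by exists v; rewrite ?ao // mem_head.
  by have := pc v; rewrite /palette; case: (c v) => [|[|[|[|]]]].
have -> : \sum_(v <- o) alone (val v) (1, map val b) * (1 < c v) = 0.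
  by apply: big1 => v _; rewrite /alone /= size_map leqNgt b2 andbF.
rewrite addn0.
(* A larger bundle contains an edge, whose ends differ in colour, so its maximum is at least 2. *)
have [u [v [ub' vb euv]]] := eb b2.
have ge2 : 2 <= \max_(v in [set v in b]) c v.
  have := cp _ _ euv; have := le_max _ ub'; have := le_max _ vb.
  by have := pc u; have := pc v; rewrite /palette; lia.
case: hasP => [[w _ /andP[wb /eqP c3]]|no3].
  by have := le_max _ wb; rewrite c3; lia.
rewrite addn0; apply/eqP; rewrite eqn_leq ge2 andbT; apply/bigmax_leqP => w.
rewrite inE => wb; have := pc w; rewrite /palette => /andP[_]; rewrite leq_eqVlt => /orP[c3|//].
by case: no3; exists w; rewrite ?ao // wb.
Qed.

(** * The walk visits the path in order *)

Definition positions n (e : rel 'I_n) (s : 'I_n -> 'I_n) :=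
  injective s /\
  forall u v, e u v = (((s u).+1 == s v :> nat) || ((s v).+1 == s u :> nat)).

(** A path can be read in both directions; the orientation will be chosen to suit the walk. *)
Lemma positions_rev n (e : rel 'I_n) s :
  positions e s -> positions e (fun v => rev_ord (s v)).
Proof.
move=> [inj es]; split=> [u v /rev_ord_inj/inj //|u v]; rewrite es /=.
by have := ltn_ord (s u); have := ltn_ord (s v); lia.
Qed.

Lemma position_at n (e : rel 'I_n) s k :
  positions e s -> k < n -> exists v, s v = k :> nat.
Proof.
move=> [inj _] kn; exists (invF inj (Ordinal kn)).
by rewrite f_invF.
Qed.

Definition edge_values n (es : seq ('I_n * 'I_n)) :=
  [seq (val uv.1, val uv.2) | uv <- es].

(** Which of two neighbours is found depends on the order of the edges and is left open: there is a
    choice only at the first step of the first walk, where either direction will do. *)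
Lemma neighbor_fold n (es : seq ('I_n * 'I_n)) (v : 'I_n) p w :
  let r := foldl (neighbor_step p (val v)) w (edge_values es) in
  let nb := fun x : 'I_n => (((v, x) \in es) || ((x, v) \in es)) && (val x != p) in
  (exists x, nb x /\ r = val x) \/ r = w /\ forall x, ~~ nb x.
Proof.
elim: es w => [|[a b] es IH] w /=; first by right; split=> // x; rewrite !in_nil.
set w' := neighbor_step _ _ _ _.
have mono (x : 'I_n) : ((v, x) \in es) || ((x, v) \in es) ->
    ((v, x) \in (a, b) :: es) || ((x, v) \in (a, b) :: es).
  by rewrite !inE => /orP[->|->]; rewrite !orbT.
case: (IH w') => [[x [/andP[/mono nx xp] ->]]|[-> no]].
  by left; exists x; rewrite nx.
rewrite /w' /neighbor_step /=.
case: ifP => [/andP[/eqP/val_inj-> ap]|Nb].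
  by left; exists a; rewrite mem_head orbT.
case: ifP => [/andP[/eqP/val_inj-> bp]|Na].
  by left; exists b; rewrite mem_head.
right; split=> // x; apply/negP => /andP[]; rewrite !inE.
have := no x; rewrite negb_and negb_or negbK => /orP[/andP[/negbTE-> /negbTE->]|/eqP->];
  last by rewrite eqxx.
rewrite !orbF => /orP[] /eqP[E1 E2] xp.
  by rewrite -E1 -E2 eqxx xp in Na.
by rewrite -E1 -E2 eqxx xp in Nb.
Qed.

Section Walk.
Variables (n : nat) (e : rel 'I_n) (es : seq ('I_n * 'I_n)).
Hypothesis ees : edge_list e es.
Let W := walk_step (edge_values es).


(* At [v], coming from [p], the walk can only move towards larger [s]. *)
Definition ahead (s : 'I_n -> 'I_n) p (v : 'I_n) :=
  forall x, e v x && (val x != p) = (s x == (s v).+1 :> nat).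

(** After a move to [x] the vertex just left is excluded in turn, so only the position following
    that of [x] remains. *)
Lemma walk_ahead s p (v : 'I_n) : positions e s -> ahead s p v ->
  (exists x, [/\ s x = (s v).+1 :> nat, W (p, val v) = (val v, val x) & ahead s (val v) x]) \/
  W (p, val v) = (p, val v) /\ n <= (s v).+1.
Proof.
move=> ps ah; have [_ _ eE] := ees; have [inj es_s] := ps; rewrite /W /walk_step /=.
have [[x []]|[-> no]] := neighbor_fold es v p (val v); last first.
  right; rewrite eqxx; split=> //; rewrite leqNgt; apply/negP => lt.
  have [x sx] := position_at ps lt.
  by have := no x; rewrite -eE ah sx eqxx.
rewrite -eE ah => /eqP sx ->; left; exists x.
have xv : val x != val v by apply/eqP => /val_inj E; rewrite E in sx; lia.
rewrite (negbTE xv); split=> // y; rewrite es_s sx.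
have -> : (val y != val v) = (s y != s v :> nat).
  by congr negb; apply/eqP/eqP => [/val_inj->|/val_inj/inj->].
by lia.
Qed.

Lemma iter_ahead s p (v : 'I_n) k : positions e s -> ahead s p v ->
  exists q w, [/\ iter k W (p, val v) = (q, val w), ahead s q w
    & s w = s v + k :> nat \/ n <= (s w).+1].
Proof.
move=> ps ah; elim: k => [|k [q [w [E ahw sw]]]].
  by exists p, v; split => //; left; rewrite addn0.
rewrite iterS E; have [[x [sx -> ahx]]|[-> le]] := walk_ahead ps ahw.
  exists (val w), x; split => //; left.
  by have := ltn_ord (s x); case: sw; lia.
by exists q, w; split => //; right.
Qed.

Lemma trail_ahead s p (v : 'I_n) k : positions e s -> ahead s p v -> s v + k <= n ->
  exists o : seq 'I_n, trail (edge_values es) k (p, val v) = map val o /\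
    map (fun x => val (s x)) o = iota (s v) k.
Proof.
move=> ps; elim: k p v => [|k IH] p v ah le; first by exists [::].
have [[x [sx Ex ahx]]|[Ex le']] := walk_ahead ps ah.
  have [|o [E1 E2]] := IH _ _ ahx; first by lia.
  by exists (v :: o); rewrite /= -/W Ex E1 E2 sx.
have k0 : k = 0 by lia.
by exists [:: v]; rewrite k0.
Qed.

(** The first step, if any, chooses a direction; once the positions are oriented along it, the
    remaining steps suffice to reach the end. A reversal then puts this end at position 0. *)
Lemma walk_reaches_end s (v : 'I_n) : positions e s ->
  exists s' w, [/\ positions e s', s' w = 0 :> nat & (iter n W (n, val v)).2 = val w].
Proof.
move=> ps; have n0 := leq_ltn_trans (leq0n v) (ltn_ord v).
suff [s' [w [ps' sw E]]] : exists s' w, [/\ positions e s', n <= (s' w).+1 &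
    (iter n W (n, val v)).2 = val w].
  exists (fun x => rev_ord (s' x)), w; split => //=; first exact: positions_rev.
  by lia.
have [_ _ eE] := ees.
have sent (x : 'I_n) : val x != n by rewrite neq_ltn ltn_ord.
have [[x [/andP[]]]|[Ew no]] := neighbor_fold es v n (val v); last first.
  have ah : ahead s n v.
    move=> x; rewrite sent andbT eE; have := no x; rewrite sent andbT => /negbTE nx.
    rewrite nx; apply/esym/eqP => sx; have [_ /(_ v x)] := ps.
    by rewrite eE nx sx eqxx.
  have [q [w [-> _ sw]]] := iter_ahead n ps ah.
  by exists s, w; split=> //; case: sw => // sw; have := ltn_ord (s w); lia.
rewrite -eE => vx _ Ew.
have [s' [ps' sx]] : exists s', positions e s' /\ s' x = (s' v).+1 :> nat.
  have [_ /(_ v x)] := ps; rewrite vx => /esym/orP[/eqP|/eqP] E; first by exists s.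
  exists (fun y => rev_ord (s y)); split; first exact: positions_rev.
  by rewrite /=; have := ltn_ord (s v); lia.
have [inj es_s] := ps'.
have xv : val x != val v by apply/eqP => /val_inj E; rewrite E in sx; lia.
have W1 : W (n, val v) = (val v, val x) by rewrite /W /walk_step /= Ew (negbTE xv).
have ah : ahead s' (val v) x.
  move=> y; rewrite es_s sx.
  have -> : (val y != val v) = (s' y != s' v :> nat).
    by congr negb; apply/eqP/eqP => [/val_inj->|/val_inj/inj->].
  by lia.
have [q [w [E _ sw]]] := iter_ahead n.-1 ps' ah.
exists s', w; split=> //.
  by case: sw => // sw; have := ltn_ord (s' w); lia.
by rewrite -[in iter n](prednK n0) iterSr W1 E.
Qed.

(** From position 0 the only way leads to larger positions, so the second walk lists the whole path
    in order. *)
Lemma trail_order s (v : 'I_n) : positions e s ->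
  let v' := (iter n W (n, val v)).2 in
  exists s' (o : seq 'I_n), [/\ positions e s',
    trail (edge_values es) n (n, v') = map val o & map (fun x => val (s' x)) o = iota 0 n].
Proof.
move=> ps; have [s' [w [ps' sw ->]]] := walk_reaches_end v ps.
have ah : ahead s' n w.
  move=> x; have [_ ->] := ps'; rewrite sw (_ : val x != n) ?neq_ltn ?ltn_ord //.
  by rewrite andbT orbF eq_sym.
have [|o [E1 E2]] := trail_ahead ps' ah (k := n); first by rewrite sw.
by exists s', o; rewrite -[0]sw.
Qed.
End Walk.

(** * Reduction to three colours *)

Lemma free_color n (e : rel 'I_n) s (c : 'I_n -> nat) v : positions e s ->
  exists2 k, palette k & forall x, e v x -> c x <> k.
Proof.
move=> [inj es].
(* Each side has at most one neighbour, hence one colour to avoid; an absent neighbour counts as 0,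
   outside the palette. *)
have side (f : 'I_n -> bool) : {in f &, forall x y, x = y} ->
    exists a, forall x, f x -> c x = a.
  move=> uf; case: (pickP f) => [x fx|f0]; last by exists 0 => x; rewrite f0.
  by exists (c x) => y fy; rewrite (uf x y).
have [|a Ha] := side (fun x => (s v).+1 == s x :> nat).
  by move=> x y; rewrite !unfold_in => /eqP Ex /eqP Ey; apply/inj/val_inj; rewrite /= -Ex -Ey.
have [|b Hb] := side (fun x => (s x).+1 == s v :> nat).
  by move=> x y; rewrite !unfold_in => /eqP Ex /eqP Ey; apply/inj/val_inj => /=; lia.
have [k kp [ka kb]] : exists2 k, palette k & a <> k /\ b <> k.
  have [|h1] := boolP ((a != 1) && (b != 1)); first by exists 1 => //; lia.
  have [|h2] := boolP ((a != 2) && (b != 2)); first by exists 2 => //; lia.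
  by exists 3 => //; lia.
by exists k => // x; rewrite es => /orP[/Ha->|/Hb->].
Qed.

(** Induction on the sum of the colours: recolouring a vertex of colour above 3 by [free_color]
    lowers the sum. *)
Lemma three_colors n (e : rel 'I_n) s (c : 'I_n -> nat) : positions e s ->
  (forall v, 0 < c v) -> (forall u v, e u v -> c u <> c v) ->
  exists c' : 'I_n -> nat, [/\ forall v, palette (c' v), forall u v, e u v -> c' u <> c' v
    & forall v, c' v <= c v].
Proof.
move=> ps; have [N] := ubnP (\sum_v c v); elim: N c => // N IH c lt c0 cp.
case: (pickP (fun v => 3 < c v)) => [v cv|le3]; last first.
  by exists c; split=> // v; rewrite /palette c0 leqNgt le3.
have [k kp kn] := free_color c v ps.
have sym u w : e u w = e w u by have [_ es] := ps; rewrite !es orbC.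
have irr u : e u u = false by have [_ es] := ps; rewrite es orbb eqn_leq ltnn.
pose c1 x := if x == v then k else c x.
have le1 x : c1 x <= c x by rewrite /c1; case: eqP => // ->; move: kp; rewrite /palette; lia.
have [| | |c' [c'p c'e c'le]] := IH c1.
- rewrite -ltnS; apply: leq_trans lt; rewrite ltnS.
  rewrite (bigD1 v) //= [X in _ < X](bigD1 v) //= -addSn; apply: leq_add.
    by rewrite /c1 eqxx; move: kp; rewrite /palette; lia.
  by apply: leq_sum => x _; exact: le1.
- by move=> x; rewrite /c1; case: eqP => // _; case/andP: kp.
- move=> u w euw; rewrite /c1; case: eqP => [Eu|_]; case: eqP => [Ew|_].
  + by move: euw; rewrite Eu Ew irr.
  + by apply/nesym/kn; rewrite -Eu.
  + by apply: kn; rewrite -Ew sym.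
  + exact: cp.
by exists c'; split=> // x; apply: leq_trans (le1 x).
Qed.

Lemma connected_convex n (e : rel 'I_n) s (B : {set 'I_n}) (o : seq 'I_n) :
  positions e s -> sorted ltn (map (fun x => val (s x)) o) -> induced_connected e B ->
  convex (fun v => v \in B) o.
Proof.
move=> [inj es] so cB; apply: (convexP so) => x y z _ _ _ /andP[xy yz] xB zB.
apply/negPn/negP => yB.
(* An edge changes the position by one, so inside [B] it cannot jump over the missing [y]. *)
have cl : closed (induced e B) (fun w => s w < s y).
  move=> u w; rewrite /induced /= es => /and3P[uB wB]; rewrite !unfold_in.
  have ne t : t \in B -> s t <> s y :> nat by move=> tB /val_inj/inj E; rewrite -E tB in yB.
  by have := ne u uB; have := ne w wB; lia.
have := closed_connect cl (cB x z xB zB); rewrite !unfold_in xy.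
by rewrite (ltnNge _ (s y)) (ltnW yz).
Qed.

Lemma connected_edge (T : finType) (e : rel T) (B : {set T}) :
  induced_connected e B -> 1 < #|B| -> exists u v, [/\ u \in B, v \in B & e u v].
Proof.
move=> cB /card_gt1P[x [y [xB yB xy]]].
have /connectP[[|z p] /= pth] := cB x y xB yB; first by move=> E; rewrite E eqxx in xy.
by case/andP: pth => /and3P[_ zB exz] _ _; exists x, z.
Qed.

(** * The cost formula for instances, and the conclusion *)

Definition bundle_values (I : instance) (bs : seq (seq 'I_(nv I))) :=
  [seq (weight [set v in b], map val b) | b <- bs].

(** Both sides are compared bundle by bundle through [bundle_max]: connectedness makes each bundle
    consecutive in [o] and gives an edge inside each one with at least two vertices. *)
Lemma cost_path_cost (I : instance) bs s (o : seq 'I_(nv I)) (c : 'I_(nv I) -> nat) :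
  bundle_list (bundles I) bs -> set0 \notin bundles I ->
  (forall B, B \in bundles I -> induced_connected (@adj I) B) ->
  positions (@adj I) s -> map (fun x => val (s x)) o = iota 0 (nv I) ->
  (forall v, palette (c v)) -> (forall u v, adj u v -> c u <> c v) ->
  cost c = base_cost (bundle_values bs) +
    path_cost (bundle_values bs) (nv I) (map val o) (map c o).
Proof.
move=> [ub pb] no0 con ps so pc cp.
have uo : uniq o.
  rewrite -(map_inj_uniq (f := fun x => val (s x))) ?so ?iota_uniq //.
  by move=> x y /val_inj/(proj1 ps).
have ao : o =i predT.
  have inj : injective (val \o s) by move=> x y /val_inj/(proj1 ps).
  by move=> v; rewrite -(mem_map inj) so mem_iota /= add0n ltn_ord.
rewrite /cost path_cost_sum /base_cost -big_split big_map.
rewrite -big_enum -(perm_big _ pb) big_map /= big_seq [RHS]big_seq.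
apply: eq_bigr => b bbs; rewrite -mulnDr; congr (_ * _).
have bB : [set v in b] \in bundles I.
  by rewrite -mem_enum -(perm_mem pb); apply: map_f.
have ubb := allP ub b bbs.
have szb : #|[set v in b]| = size b by rewrite cardsE; apply/card_uniqP.
apply: (bundle_max pc cp uo ao ubb).
- by rewrite -szb card_gt0; apply: contraNneq no0 => <-.
- have := connected_convex ps _ (con _ bB) (o := o); rewrite so iota_ltn_sorted => /(_ isT).
  by rewrite (@eq_convex _ _ (fun v => v \in b)) // => v; rewrite inE.
- rewrite -szb => /(connected_edge (con _ bB))[u [v [uB vB euv]]].
  by exists u, v; rewrite !inE in uB vB.
Qed.

Lemma encoding_bounds (I : instance) (es : seq ('I_(nv I) * 'I_(nv I))) bs :
  edge_list (@adj I) es -> bundle_list (bundles I) bs ->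
  [/\ size (edge_values es) <= nv I * nv I, size (bundle_values bs) = #|bundles I|,
    all (fun b => size b.2 <= nv I) (bundle_values bs)
  & forall b, b \in bundle_values bs -> nv I \notin b.2].
Proof.
move=> [ues _ _] [ub pb]; split.
- by rewrite size_map -(card_uniqP ues) (leq_trans (max_card _)) // card_prod card_ord.
- by rewrite size_map cardE -(perm_size pb) size_map.
- apply/allP => _ /mapP[b bbs ->] /=; rewrite size_map -(card_uniqP (allP ub b bbs)).
  by rewrite (leq_trans (max_card _)) // card_ord.
move=> _ /mapP[b _ ->] /=; apply/negP => /mapP[[v vn] _ /= E].
by rewrite -E ltnn in vn.
Qed.

Lemma sorted_colors n (e : rel 'I_n) s (o : seq 'I_n) (c : 'I_n -> nat) :
  positions e s -> map (fun x => val (s x)) o = iota 0 n ->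
  (forall u v, e u v -> c u <> c v) -> sorted differ (map c o).
Proof.
move=> [_ es] so cp; rewrite sorted_map.
case: o so => // v o so; apply/(sortedP v) => i lt.
have nth_s j : j < size (v :: o) -> s (nth v (v :: o) j) = j :> nat.
  move=> jl; rewrite -(nth_map v 0 (fun x => val (s x))) // so nth_iota //.
  by rewrite -(size_iota 0 n) -so size_map.
by apply/eqP/cp; rewrite es !nth_s ?eqxx // ltnW.
Qed.

Theorem theorem9 :
  solvable_in_time
    (fun I : instance =>
       is_path (@adj I) /\
       forall B : {set 'I_(nv I)}, B \in bundles I -> induced_connected (@adj I) B)
    (fun I : instance => nv I ^ 3 * #|bundles I|).
Proof.
exists program, 3000 => I x [_ no0 cov _ _] [[n0 [s0 [inj0 es0]]] con] [es [bs [ees ebs ->]]].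
have ps0 : positions (@adj I) s0 by [].
have [esn szb ab nb] := encoding_bounds ees ebs.
have bl0 : 0 < size (bundle_values bs).
  rewrite szb card_gt0; apply/eqP => B0; have := cov; rewrite B0 /cover big_set0.
  by move/setP/(_ (Ordinal n0)); rewrite !inE.
have [s [o [ps tr so]]] := trail_order ees (Ordinal n0) ps0.
have := programP (budget I) n0 esn bl0 ab; rewrite szb /= tr.
have -> : [:: nv I, size (edge_values es), #|bundles I|, budget I
    & edge_code (edge_values es) ++ bundle_code (bundle_values bs)] =
  [:: nv I; size es; size bs; budget I] ++ flatten [seq [:: val uv.1; val uv.2] | uv <- es]
     ++ flatten [seq [:: weight [set v in b], size b & map val b] | b <- bs].
  rewrite -szb !size_map /edge_code /bundle_code /edge_values /bundle_values -!map_comp /=.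
  by congr [:: _, _, _, _ & _ ++ flatten _]; apply: eq_map => b /=; rewrite size_map.
set D := dp _ _ _ _ _ => -[t [s' [ex le [out1 out0]]]].
exists t, s'.
have szo : size (map val o) = nv I by have := congr1 size so; rewrite !size_map size_iota.
have o0 : 0 < size (map val o) by rewrite szo.
(* The cost is monotone in the colours, so passing to three colours does not raise it. *)
have lower (c : 'I_(nv I) -> nat) : proper_coloring c -> reg s' 1 <= cost c.
  move=> [c0 cp]; have [c' [pc' cp' le']] := three_colors ps c0 cp.
  apply: leq_trans (_ : cost c' <= _); last first.
    apply: leq_sum => B _; rewrite leq_mul2l; apply/orP; right.
    apply/bigmax_leqP => v vB; apply: leq_trans (le' v) _.
    exact: (leq_bigmax_cond v vB).
  rewrite out1 (cost_path_cost ebs no0 con ps so pc' cp') leq_add2l.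
  apply: dp_min_lower => //; first by rewrite !size_map.
  rewrite /colors_path (sorted_colors ps so cp') all_map.
  by apply/allP => v _; apply: pc'.
have [c [pc cost_c]] : exists c : 'I_(nv I) -> nat, proper_coloring c /\ cost c = reg s' 1.
  have [ys [szy /andP[sy py] DE]] := dp_min_achieved nb o0.
  rewrite szo in szy.
  (* The colours found are listed in path order, so [v] takes the one at its position. *)
  pose c v := nth 0 ys (s v).
  have co : map c o = ys.
    rewrite (map_comp (nth 0 ys) (fun v => val (s v))) so -[RHS](mkseq_nth 0) szy.
    by [].
  have pc v : palette (c v) by apply: (allP py); rewrite mem_nth // szy.
  have cp u v : adj u v -> c u <> c v.
    have [_ ->] := ps => /orP[] /eqP E; [|apply/nesym]; apply/eqP;
    rewrite /c -E; apply: (sortedP 0 sy); rewrite szy E; exact: ltn_ord.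
  exists c; split; first by split=> // v; case/andP: (pc v).
  by rewrite out1 (cost_path_cost ebs no0 con ps so pc cp) co -DE.
split=> //; last by split; [exists c|].
rewrite out0 subn_gt0 ltnS; split=> [le1|[c' [pc' le']]]; first by exists c; rewrite cost_c.
exact: leq_trans (lower _ pc') le'.
Qed.
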